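(* Let $L$ be the number of irreducible constituents of the $U$-module $Top$. Then $L$ is equal to the number of $U$-orbits of $V\setminus y^2V$.
   Context: Setting. $R$ is a finite commutative local principal ring of odd prime characteristic $p$, with maximal ideal $\mathfrak m$ of nilpotency degree $\ell\ge 1$ and residue field $R/\mathfrak m\cong F_q$. Let $x$ be a generator of $\mathfrak m$ and $A=R[t]/(t^2-x)=R\oplus Ry$, $y^2=x$ (ramified quadratic extension of $R$), with involution $(r+sy)^*=r-sy$ ($r,s\in R$). $A$ is a finite local principal ring with maximal ideal $\mathfrak r=Ay$ of nilpotency degree $2\ell$ and residue field $F_q$. Put $\mathfrak i=\mathfrak r^\ell=Ay^\ell$. $V$ is a free $A$-module of finite rank $m\ge 1$ and $h:V\times V\to A$ is a non-degenerate hermitian form: $h$ is bi-additive, $A$-linear in the second variable, $h(v,u)=h(u,v)^*$, and $v\mapsto h(v,-)$ is a bijection $V\to \mathrm{Hom}_A(V,A)$. $U=\{g\in \mathrm{GL}_A(V): h(gu,gv)=h(u,v)\ \forall u,v\in V\}$. Let $d:A\to R$, $d(r+sy)=2s$. Fix a primitive linear character $\lambda:R^+\to\mathbf C^\times$ (its kernel contains no non-zero ideal of $R$) and put $\mu=\lambda\circ d:A^+\to\mathbf C^\times$. Weil module. Let $T$ be a transversal for $\mathfrak iV$ in $V$. The Weil module $X$ (of type $\mu$) is the complex $U$-module with basis $\{e_v: v\in T\}$ and action $ge_v=\mu(h(gv,v'))e_{v'}$ for $g\in U$, $v,v'\in T$, $gv\equiv v' \bmod \mathfrak iV$. A vector $v\in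 V$ is primitive if $v\notin yV$. $Top$ is the $U$-submodule of $X$ spanned by the $e_v$ with $v\in T$ primitive. ($Top$ is multiplicity free.) *)

(* Defs.v *)
From HB Require Import structures.
From mathcomp Require Import all_boot all_order all_algebra all_fingroup.
From mathcomp Require Import qpoly mxrepresentation.
From mathcomp Require Import complex reals ring.

Set Implicit Arguments.
Unset Strict Implicit.
Unset Printing Implicit Defensive.

Import Order.TTheory GRing.Theory Num.Theory.
Local Open Scope ring_scope.

Section FiniteCommutativeRings.
Variable R : finComNzRingType.
Implicit Types I J S M : {set R}.

(* Improper ideals are allowed, unlike in [idealr_closed] of ring_quotient. *)
Definition is_ideal I : bool :=
  (0 \in I) && [forall a, forall u in I, forall v in I, a * u + v \in I].

Definition pideal (x : R) : {set R} := [set a * x | a : R].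

Definition principal_ring : Prop :=
  forall I, is_ideal I -> exists x, I = pideal x.

Definition maximal_ideal M : bool :=
  maxset (fun I => is_ideal I && (I != [set: R])) M.

Definition local_ring M : Prop := forall J, maximal_ideal J = (J == M).

Definition ideal_gen S : {set R} :=
  \bigcap_(I : {set R} | is_ideal I && (S \subset I)) I.

Definition ideal_mul I J : {set R} := ideal_gen [set a * b | a in I, b in J].

Definition ideal_exp I n : {set R} := iter n (ideal_mul I) [set: R].

Definition nilpotency_degree I n : Prop :=
  ideal_exp I n = [set 0] /\ forall k, (k < n)%N -> ideal_exp I k <> [set 0].

Lemma mem_ideal_exp_pideal x n : x ^+ n \in ideal_exp (pideal x) n.
Proof.
elim: n => [|n IHn]; first by rewrite inE.
apply/bigcapP => I /andP[_ /subsetP sSI]; apply: sSI; rewrite exprS.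
by apply: imset2_f => //; apply/imsetP; exists 1; rewrite ?mul1r.
Qed.

Lemma nilpotent_generator x n : nilpotency_degree (pideal x) n -> x ^+ n = 0.
Proof. by case=> En _; apply/set1P; rewrite -En mem_ideal_exp_pideal. Qed.

Section Characters.
Variable C : fieldType.

Definition additive_char (lam : R -> C) : Prop :=
  lam 0 = 1 /\ {morph lam : a b / a + b >-> a * b}.

Definition primitive_char (lam : R -> C) : Prop :=
  forall I, is_ideal I -> {in I, forall a, lam a = 1} -> I = [set 0].

End Characters.
End FiniteCommutativeRings.

(* A = R[t]/(t^2 - x); an element r + s y of A, with y the class of t, is a    *)
(* polynomial of degree at most 1 with coefficients r (in degree 0) and s.     *)
Definition ramified_ext (R : finComNzRingType) (x : R) : Type :=
  {poly %/ 'X^2 - x%:P}.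

HB.instance Definition _ (R : finComNzRingType) (x : R) :=
  Finite.copy (ramified_ext x) {poly %/ 'X^2 - x%:P}.
HB.instance Definition _ (R : finComNzRingType) (x : R) :=
  GRing.ComNzRing.copy (ramified_ext x) {poly %/ 'X^2 - x%:P}.

Definition ramC (R : finComNzRingType) (x : R) (r : R) : ramified_ext x :=
  qpolyC _ r.
Definition ramY (R : finComNzRingType) (x : R) : ramified_ext x := 'qX.

Section Ramified.
Variables (R : finComNzRingType) (x : R).
Local Notation A := (ramified_ext x).
Local Notation y := (ramY x).

(* The coordinates r and s of r + s y. *)
Definition ram0 (a : A) : R := (a : {poly R})`_0.
Definition ram1 (a : A) : R := (a : {poly R})`_1.

Definition conjA (a : A) : A := ramC x (ram0 a) - ramC x (ram1 a) * y.

Definition dA (a : A) : R := ram1 a *+ 2.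

Section RamifiedTheory.

Let P := 'X^2 - x%:P : {poly R}.

Let size_P : size P = 3.
Proof. by rewrite /P size_XnsubC. Qed.

Let monic_P : P \is monic.
Proof. by rewrite /P monicXnsubC. Qed.

Let mk_monic_P : mk_monic P = P.
Proof. by rewrite /mk_monic size_P monic_P. Qed.

Let rmod_P (q r : {poly R}) : (size r <= 2)%N ->
  Pdiv.CommonRing.rmodp (q * P + r) (mk_monic P) = r.
Proof.
by move=> sr; rewrite mk_monic_P Pdiv.RingMonic.rmodp_addl_mul_small ?size_P.
Qed.

Let size_ram (a : A) : (size (a : {poly R}) <= 2)%N.
Proof. by apply: leq_trans (size_npoly a) _; rewrite mk_monic_P size_P. Qed.

Lemma ramP (a b : A) : ram0 a = ram0 b -> ram1 a = ram1 b -> a = b.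
Proof.
rewrite /ram0 /ram1 => e0 e1; apply: val_inj; apply/polyP => -[|[|i]] //.
by rewrite !nth_default // (leq_trans (size_ram _)).
Qed.

Lemma ram0D a b : ram0 (a + b) = ram0 a + ram0 b. Proof. exact: coefD. Qed.
Lemma ram1D a b : ram1 (a + b) = ram1 a + ram1 b. Proof. exact: coefD. Qed.
Lemma ram0N a : ram0 (- a) = - ram0 a. Proof. exact: coefN. Qed.
Lemma ram1N a : ram1 (- a) = - ram1 a. Proof. exact: coefN. Qed.
Lemma ram0C r : ram0 (ramC x r) = r. Proof. by rewrite /ram0 coefC. Qed.
Lemma ram1C r : ram1 (ramC x r) = 0. Proof. by rewrite /ram1 coefC. Qed.

Lemma ram0Y : ram0 y = 0.
Proof. by rewrite /ram0 /ramY qpolyXE ?size_P // coefX. Qed.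

Lemma ram1Y : ram1 y = 1.
Proof. by rewrite /ram1 /ramY qpolyXE ?size_P // coefX. Qed.

Lemma ramM (a b : A) :
  (ram0 (a * b) = ram0 a * ram0 b + x * (ram1 a * ram1 b)) *
  (ram1 (a * b) = ram0 a * ram1 b + ram1 a * ram0 b).
Proof.
pose r := (ram0 a * ram0 b + x * (ram1 a * ram1 b))%:P
  + (ram0 a * ram1 b + ram1 a * ram0 b) *: 'X.
have poly2 (c : A) : (c : {poly R}) = (ram0 c)%:P + (ram1 c) *: 'X.
  apply/polyP=> i; rewrite coefD coefC coefZ coefX /ram0 /ram1.
  case: i => [|[|i]] /=; rewrite ?mulr0 ?mulr1 ?addr0 ?add0r //.
  by rewrite nth_default // (leq_trans (size_ram _)).
suff e : (a * b : A) = r :> {poly R}.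
  rewrite /ram0 /ram1 e /r; rewrite !coefD !coefC !coefZ !coefX /=.
  by rewrite mulr0 mulr1 addr0 add0r.
rewrite poly_of_qpolyM -[RHS](rmod_P (ram1 a * ram1 b)%:P); last first.
  rewrite /r (leq_trans (size_polyD _ _)) // geq_max size_polyC.
  rewrite (leq_trans (size_scale_leq _ _)) ?size_polyX // andbT.
  by case: eqP.
congr (Pdiv.CommonRing.rmodp _ _); rewrite (poly2 a) (poly2 b) /r /P.
by rewrite -!mul_polyC !rmorphD !rmorphM /=; ring.
Qed.

Lemma conjA0 a : ram0 (conjA a) = ram0 a.
Proof.
by rewrite /conjA ram0D ram0N !ramM !(ram0C, ram1C, ram0Y, ram1Y); ring.
Qed.

Lemma conjA1 a : ram1 (conjA a) = - ram1 a.
Proof.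
by rewrite /conjA ram1D ram1N !ramM !(ram0C, ram1C, ram0Y, ram1Y); ring.
Qed.

Lemma conjAD a b : conjA (a + b) = conjA a + conjA b.
Proof.
by apply: ramP; rewrite !(conjA0, conjA1, ram0D, ram1D) // opprD.
Qed.

Lemma conjA_Xn n a : conjA (y ^+ n * a) = (-1) ^+ n * (y ^+ n * conjA a).
Proof.
elim: n a => [|n IHn] a; first by rewrite !expr0 !mul1r.
rewrite (exprSr y) -mulrA IHn; suff -> : conjA (y * a) = - (y * conjA a).
  by rewrite (exprSr (-1)) mulrN1 mulrN -mulrA mulrN mulNr.
apply: ramP; rewrite !(ram0N, ram1N, conjA0, conjA1, ramM, ram0Y, ram1Y); ring.
Qed.

Lemma dAD a b : dA (a + b) = dA a + dA b.
Proof. by rewrite /dA ram1D mulrnDl. Qed.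

Lemma dA_conj a : conjA a = a -> dA a = 0.
Proof.
by move=> ea; rewrite /dA mulr2n -{1}ea conjA1 addNr.
Qed.

Lemma ramY2 : y ^+ 2 = ramC x x.
Proof.
by apply: ramP; rewrite expr2 !(ramM, ram0Y, ram1Y, ram0C, ram1C); ring.
Qed.

Lemma ramY_nilp n : x ^+ n = 0 -> y ^+ (n + n) = 0.
Proof.
move=> xn0; rewrite addnn -mul2n exprM ramY2.
by rewrite /ramC -rmorphXn xn0 rmorph0.
Qed.

End RamifiedTheory.

Section HermitianForms.
Variable V : finLmodType A.

Definition free_of_rank (m : nat) : Prop :=
  exists b : 'I_m -> V, bijective (fun c : 'rV[A]_m => \sum_i c 0 i *: b i).

(* y^n V *)
Definition yV (n : nat) : {set V} := [set y ^+ n *: v | v : V].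

Variable h : V -> V -> A.

Record hermitian_form : Prop := Hermitian {
  hermDl : forall u v w, h (u + v) w = h u w + h v w;
  hermDr : forall u v w, h u (v + w) = h u v + h u w;
  hermZr : forall a u v, h u (a *: v) = a * h u v;
  hermC : forall u v, h v u = conjA (h u v)
}.

(* [{scalar V}] is Hom_A(V, A). *)
Definition nondegenerate_form : Prop :=
  forall f : {scalar V}, exists! v, h v =1 f.

Definition unitary_set : {set {perm V}} :=
  [set g : {perm V} |
    [forall a : A, forall u : V, forall v : V,
       g (a *: u + v) == a *: g u + g v]
    && [forall u, forall v, h (g u) (g v) == h u v]].

Lemma unitaryP (g : {perm V}) :
  reflect (linear g /\ forall u v, h (g u) (g v) = h u v) (g \in unitary_set).
Proof.
rewrite inE; apply: (iffP andP) => -[lg hg]; split.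
- by move=> a u v; move/forallP/(_ a)/forallP/(_ u)/forallP/(_ v)/eqP: lg.
- by move=> u v; move/forallP/(_ u)/forallP/(_ v)/eqP: hg.
- by do 3![apply/forallP=> ?]; rewrite lg.
- by do 2![apply/forallP=> ?]; rewrite hg.
Qed.

Lemma unitary_group_set : group_set unitary_set.
Proof.
apply/group_setP; split=> [|g1 g2 /unitaryP[l1 h1] /unitaryP[l2 h2]].
  by apply/unitaryP; split=> [a u v|u v]; rewrite !perm1.
by apply/unitaryP; split=> [a u v|u v]; rewrite !permM ?l1 ?l2 ?h2 ?h1.
Qed.

Definition unitary := Group unitary_group_set.

End HermitianForms.

Section WeilModule.
Variables (C : fieldType) (V : finLmodType A) (h : V -> V -> A).
Variables (lam : R -> C) (l : nat) (T : {set V}).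

Definition transversal_mod (W : {set V}) : Prop :=
  is_transversal T (equivalence_partition (fun u v => u - v \in W) [set: V])
    [set: V].

Definition mu (a : A) : C := lam (dA a).

(* Row v is g e_v. Matrices act on row vectors on the right and permutations   *)
(* compose left to right, so this is the left action of U on X.                *)
Definition weil_mx (g : {perm V}) : 'M[C]_#|T| :=
  \matrix_(i, j) let v := enum_val i in let v' := enum_val j in
    if g v - v' \in yV V l then mu (h (g v) v') else 0.

Hypotheses (nilM : nilpotency_degree (pideal x) l).
Hypotheses (hermh : hermitian_form h) (lamP : additive_char lam).
Hypothesis trT : transversal_mod (yV V l).

Local Notation iV := (yV V l).

Lemma yVP n (v : V) : reflect (exists u, v = y ^+ n *: u) (v \in yV V n).
Proof.
by apply: (iffP imsetP) => [[u _ ->]|[u ->]]; exists u.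
Qed.

Lemma yV0 n : 0 \in yV V n.
Proof. by apply/yVP; exists 0; rewrite scaler0. Qed.

Lemma yVB n : {in yV V n &, forall u v, u - v \in yV V n}.
Proof.
by move=> _ _ /yVP[u ->] /yVP[v ->]; apply/yVP; exists (u - v); rewrite scalerBr.
Qed.

Lemma yVN n v : v \in yV V n -> - v \in yV V n.
Proof. by move=> vW; rewrite -(sub0r v) yVB ?yV0. Qed.

Lemma yVD n : {in yV V n &, forall u v, u + v \in yV V n}.
Proof. by move=> u v uW vW; rewrite -(opprK v) yVB ?yVN. Qed.

Lemma yVS n k : (k <= n)%N -> yV V n \subset yV V k.
Proof.
move=> le_kn; apply/subsetP => _ /yVP[v ->]; apply/yVP.
by exists (y ^+ (n - k) *: v); rewrite scalerA -exprD subnKC.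
Qed.

Lemma transversal_modP v : exists2 t, t \in T & v - t \in iV /\
  forall s, s \in T -> v - s \in iV -> s = t.
Proof.
have /and3P[_ _ /forall_inP/(_ [set w in [set: V] | v - w \in iV])] := trT.
rewrite imset_f ?inE // => /(_ isT)/cards1P[t /setP et].
have:= et t; rewrite !inE eqxx /= => /andP[tT vt]; exists t => //; split=> // s sT vs.
by apply/set1P; rewrite -et !inE sT.
Qed.

Lemma transversal_rank v : exists2 i : 'I_#|T|, v - enum_val i \in iV &
  forall j : 'I_#|T|, v - enum_val j \in iV -> j = i.
Proof.
have [t tT [vt ut]] := transversal_modP v.
exists (enum_rank_in tT t) => [|j vj]; first by rewrite enum_rankK_in.
by apply: enum_val_inj; rewrite enum_rankK_in // (ut _ (enum_valP j)).
Qed.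

Lemma muD a b : mu (a + b) = mu a * mu b.
Proof. by rewrite /mu dAD (proj2 lamP). Qed.

Lemma mu_conj a : conjA a = a -> mu a = 1.
Proof. by move=> ea; rewrite /mu dA_conj // (proj1 lamP). Qed.

Lemma mu_herm v : mu (h v v) = 1.
Proof. by rewrite mu_conj // -(hermC hermh). Qed.

Lemma mu_hermC u v : mu (h u v) * mu (h v u) = 1.
Proof.
by rewrite -muD mu_conj // conjAD -!(hermC hermh) addrC.
Qed.

Lemma herm_iV u v : u \in iV -> v \in iV -> h u v = 0.
Proof.
move=> /yVP[{}u ->] /yVP[{}v ->]; rewrite (hermZr hermh) (hermC hermh).
rewrite (hermZr hermh) conjA_Xn mulrCA; set b := conjA _.
rewrite (mulrA (y ^+ l)) -exprD (ramY_nilp (nilpotent_generator nilM)).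
by rewrite mul0r mulr0.
Qed.

Lemma unitary_yV n (g : {perm V}) v :
  g \in unitary h -> v \in yV V n -> g v \in yV V n.
Proof.
case/unitaryP=> lg _ /yVP[u ->]; apply/yVP; exists (g u).
have g0 : g 0 = 0 by have:= lg (-1) 0 0; rewrite scaler0 addr0 scaleN1r addNr.
by rewrite -[in LHS](addr0 (_ *: u)) lg g0 addr0.
Qed.

Lemma unitaryB (g : {perm V}) u v : g \in unitary h -> g (u - v) = g u - g v.
Proof.
by case/unitaryP=> lg _; rewrite addrC -scaleN1r lg scaleN1r addrC.
Qed.

Lemma weil_mx_repr : mx_repr (unitary h) weil_mx.
Proof.
split=> [|g1 g2 U1 U2]; apply/matrixP=> i j; rewrite !mxE /=.
  have [k ki uk] := transversal_rank (enum_val i).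
  have ik : i = k by apply: uk; rewrite subrr yV0.
  rewrite perm1; case: ifP => [/uk ->|]; first by rewrite -ik eqxx mu_herm.
  by case: eqP => // <-; rewrite subrr yV0.
have [k ik uk] := transversal_rank (g1 (enum_val i)).
rewrite (bigD1 k) //= big1 => [|k' nk']; last first.
  by rewrite !mxE /=; case: ifP => [/uk/eqP|]; rewrite ?(negPf nk') ?mul0r.
rewrite addr0 !mxE /= ik permM; set v := g1 _ in ik *; set w := enum_val k in ik *.
set z := enum_val j.
have gvw : g2 v - g2 w \in iV by rewrite -unitaryB ?unitary_yV.
have -> : (g2 v - z \in iV) = (g2 w - z \in iV).
  have e : g2 v - z = (g2 v - g2 w) + (g2 w - z) by rewrite addrA subrK.
  apply/idP/idP => hz; last by rewrite e yVD.
  have -> : g2 w - z = (g2 v - z) - (g2 v - g2 w) by rewrite opprB [RHS]addrC addrA subrK.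
  exact: yVB.
case: ifP => wz; last by rewrite mulr0.
have [_ hg2] := unitaryP _ _ U2.
have hB a b c : h (a - b) c + h b c = h a c by rewrite -(hermDl hermh) subrK.
rewrite -(hB (g2 v) (g2 w) z) muD; congr (_ * _).
have -> : h (g2 v - g2 w) z = h (v - w) w.
  have e : h (g2 v - g2 w) (g2 w - z) = 0 by apply: herm_iV.
  have <- : h (g2 v - g2 w) (g2 w) = h (g2 v - g2 w) z.
    by rewrite -[RHS]add0r -e -(hermDr hermh) subrK.
  by rewrite -unitaryB // hg2.
rewrite -[in RHS](hB v w w) muD mu_herm mulr1 //.
Qed.

Definition weil_repr : mx_representation C (unitary h) #|T| :=
  MxRepresentation weil_mx_repr.

(* Row vectors are vectors of X; e_v is the row vector [delta_mx 0 i] for the  *)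
(* index i of v in the enumeration of T.                                       *)
Definition Top_mx : 'M[C]_#|T| :=
  (\sum_(i < #|T| | enum_val i \notin yV V 1) <<delta_mx 0 i : 'rV_#|T|>>)%MS.

Hypothesis l_gt0 : (0 < l)%N.

Lemma Top_module : mxmodule weil_repr Top_mx.
Proof.
apply/mxmoduleP=> g Ug; rewrite sumsmxMr; apply/sumsmx_subP=> i ni.
rewrite (eqmxMr _ (genmxE _)) -rowE (row_sum_delta (row i _)).
apply: summx_sub => j _; rewrite !mxE /=; case: ifP => [gij|]; last first.
  by rewrite scale0r sub0mx.
apply: scalemx_sub; rewrite (sumsmx_sup j) ?genmxE //.
apply: contra ni => yj; rewrite -(permK g (enum_val i)) unitary_yV ?groupV //.
by rewrite -(subrK (enum_val j) (g _)) yVD // (subsetP (yVS l_gt0)).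
Qed.

(* The U-module Top, as a representation on the coordinates in a basis of the  *)
(* submodule [Top_mx] of X.                                                    *)
Definition Top_repr : mx_representation C (unitary h) (\rank Top_mx) :=
  submod_repr Top_module.

End WeilModule.
End Ramified.

(* The components of a representation are its isotypic submodules, one for     *)
(* each isomorphism class of irreducible constituents.                         *)
Definition nb_irr_constituents (F : decFieldType) (gT : finGroupType)
    (G : {group gT}) (n : nat) (rG : mx_representation F G n) : nat :=
  #|DecSocleType rG|.

(* Main.v *)
Require Import Defs.
From HB Require Import structures.
From mathcomp Require Import all_boot all_order all_algebra all_fingroup.
From mathcomp Require Import mxrepresentation complex reals ring.

Set Implicit Arguments.
Unset Strict Implicit.
Unset Printing Implicit Defensive.

Import Order.TTheory GRing.Theory Num.Theory.
Local Open Scope ring_scope.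

(* The Heisenberg operators heis w, w in V, form a basis of End(X) that U
   permutes as it permutes V, so that End_U(X) has a basis indexed by the
   U-orbits of V. A semilinear involution sigma of V with
   h(sigma u, sigma v) = h(v, u) that preserves every U-orbit induces an
   anti-automorphism of End(X) fixing End_U(X), which is therefore
   commutative. Hence the number of irreducible constituents of Top is
   dim End_U(Top), that is, dim End_U(X) minus the dimension of the space of
   those elements of End_U(X) that vanish on Top. These are the combinations
   of Heisenberg operators with U-invariant coefficients that are supported on
   yV and constant on cosets of y^(2l-1)V, the annihilator of y; through
   multiplication by y they are the functions on the U-orbits of y^2V. *)

(** * Representations with a commutative centralizer *)

Section Families.
Variables (F : fieldType) (vT : vectType F) (I : finType) (A : {pred I}).
Variable v : I -> vT.

Lemma span_image w :
  w \in <<[seq v i | i in A]>>%VS ->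
  exists f : I -> F, w = \sum_(i in A) f i *: v i.
Proof.
move/(@coord_span _ _ _ [tuple of image v A]) => ew.
have [i0 Ai0|A0] := pickP A; last first.
  exists (fun _ => 0); rewrite [RHS]big_pred0 // ew big1 // => k _.
  by have := ltn_ord k; rewrite {2}(eq_card0 A0).
exists (fun i => coord [tuple of image v A] (enum_rank_in Ai0 i) w).
rewrite {1}ew [RHS]big_enum_val /=; apply: eq_bigr => k _; rewrite enum_valK_in.
by rewrite (nth_map i0) -?cardE // -enum_val_nth.
Qed.

Hypothesis indep :
  forall f : I -> F, \sum_(i in A) f i *: v i = 0 -> {in A, forall i, f i = 0}.

Lemma dim_span_image : \dim <<[seq v i | i in A]>>%VS = #|A|.
Proof.
suff /eqP-> : free [tuple of image v A] by rewrite size_tuple.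
apply/freeP => k k0 i; have := enum_valP i; set j := enum_val i => Aj.
have := indep (f := fun j => k (enum_rank_in Aj j)) _ Aj; rewrite enum_valK_in;
  apply.
rewrite -[RHS]k0 big_enum_val; apply: eq_bigr => s _; rewrite enum_valK_in.
by rewrite (nth_map j) -?cardE // -enum_val_nth.
Qed.

End Families.

Section CommutativeCentralizer.
Variables (F : closedFieldType) (gT : finGroupType) (G : {group gT}) (n : nat).
Variables (rG : mx_representation F G n) (E : {vspace 'M[F]_n}).
Hypothesis redG : mx_completely_reducible rG 1%:M.
Hypothesis memE : forall c, reflect {in G, forall g, c *m rG g = rG g *m c}
  (c \in E).
Hypothesis commE : {in E &, forall c d, c *m d = d *m c}.

Let hom_memE c : (1%:M <= dom_hom_mx rG c)%MS -> c \in E.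
Proof.
move/hom_mxP => hc; apply/memE => g Gg; have := hc g Gg.
by rewrite !mul1mx.
Qed.

(** Complete reducibility gives a stable complement, and the projection along it commutes with [G].
    Since this projection lies in the commutative [E], every element of [E] preserves [M]. *)
Lemma simple_projection (M : 'M_n) :
  mxsimple rG M -> exists2 P, P \in E & (P <= M)%MS /\ M *m P = M.
Proof.
move=> simM; have modM := mxsimple_module simM.
have [N modN defN /mxdirect_addsP dxMN] := redG modM (submx1 _).
exists (proj_mx M N); last first.
  by rewrite -{1}[proj_mx M N]mul1mx proj_mx_sub proj_mx_id.
by apply: hom_memE; rewrite -defN proj_mx_hom.
Qed.

(** [c] maps [M] into itself, so it has an eigenvalue [a] there, [F] being algebraically closed. The
    kernel of [c - a%:M] meets [M] non-trivially and contains [M] by Schur's lemma. *)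
Lemma simple_eigenvalue (M c : 'M_n) :
  mxsimple rG M -> c \in E -> exists a, (M <= kermx (c - a%:M))%MS.
Proof.
move=> simM Ec; have [P EP [sPM MP]] := simple_projection simM.
have McM : (M *m c <= M)%MS.
  by rewrite -{1}MP -mulmxA (commE EP Ec) mulmxA; apply: mulmx_sub.
have rM_gt0 : (0 < \rank M)%N by have [_ nzM _] := simM;
  rewrite lt0n mxrank_eq0.
pose c0 := in_submod M (val_submod (1%:M : 'M_(\rank M)) *m c).
have /closed_rootP[a ra] : size (char_poly c0) != 1.
  by rewrite size_char_poly eqSS -lt0n.
have /eigenvalueP[v vc nzv] : eigenvalue c0 a by rewrite eigenvalue_root_char.
exists a; apply/sub_kermxP/eqP; apply/negPn/negP => nzMc.
have homc : (M <= dom_hom_mx rG (c - a%:M))%MS.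
  apply/hom_mxP => g Gg; rewrite -!mulmxA; congr (_ *m _).
  by rewrite mulmxBl mulmxBr (memE _ Ec) // scalar_mxC.
have /eqP := mx_Schur_inj simM homc nzMc; apply/negP/rowV0Pn.
exists (val_submod v); last by rewrite val_submod_eq0.
rewrite sub_capmx val_submodP; apply/sub_kermxP; rewrite mulmxBr mul_mx_scalar.
apply/eqP; rewrite subr_eq0; apply/eqP.
have -> : a *: val_submod v = val_submod (a *: v) by rewrite linearZ.
rewrite -vc /c0 in_submodE mulmxA -in_submodE in_submodK.
  by rewrite mulmxA -val_submodE.
apply: submx_trans McM; rewrite mulmxA -val_submodE.
by rewrite submxMr // val_submodP.
Qed.

(** The component is a sum of images of [M] under homomorphisms [f]. Composed with the projection
    [P] onto [M], such an [f] becomes an element of [E], so it commutes with [c] and carries the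
    eigenvalue along. *)
Lemma component_eigenvalue (M c : 'M_n) :
  mxsimple rG M -> c \in E ->
  exists a, component_mx rG M *m c = a *: component_mx rG M.
Proof.
move=> simM Ec; have [a /sub_kermxP Mc] := simple_eigenvalue simM Ec; exists a.
apply/eqP; rewrite -subr_eq0 -mul_mx_scalar -mulmxBr; apply/eqP/sub_kermxP.
have [I [W isoW ->]] := component_mx_def simM.
apply/sumsmx_subP => i _; have [f _ homf <-] := isoW i.
have [P EP [sPM MP]] := simple_projection simM.
have Ef : P *m f \in E.
  apply/memE => g Gg.
  have /hom_mxP/(_ g Gg) <- : (P <= dom_hom_mx rG f)%MS by apply: submx_trans
    homf.
  by rewrite (memE _ EP) // mulmxA.
have comm : P *m f *m (c - a%:M) = (c - a%:M) *m (P *m f).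
  by rewrite mulmxBr mulmxBl (commE Ef Ec) scalar_mxC.
apply/sub_kermxP; rewrite -MP -(mulmxA M) -(mulmxA M) comm.
by rewrite (mulmxA M) Mc mul0mx.
Qed.

(** The projections onto the isotypic components form a basis of [E], because an element of [E] is a
    scalar on each component. *)
Lemma card_socle_dim (sG : socleType rG) : #|sG| = \dim E.
Proof.
have soc1 : (1%:M <= \sum_(W : sG) W)%MS by rewrite -(reducible_Socle1 sG redG).
pose N (W : sG) := (\sum_(W' : sG | W' != W) W')%MS.
have dx (W : sG) : (W :&: N W = 0)%MS by have /mxdirect_sumsP/(_ W isT) :=
  Socle_direct sG.
pose P (W : sG) := proj_mx W (N W).
have PW (W W' : sG) : W *m P W' = if W' == W then W : 'M_n else 0.
  case: eqP => [->|/eqP neW]; first by rewrite proj_mx_id.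
  by rewrite proj_mx_0 // (sumsmx_sup W) // eq_sym.
have EP (W : sG) : P W \in E.
  apply: hom_memE; apply: submx_trans (proj_mx_hom (dx W) _ _).
  - by apply: submx_trans soc1 _; rewrite (bigD1 W).
  - exact: component_mx_module.
  by apply: sumsmx_module => W' _; apply: component_mx_module.
have sumP (k : sG -> F) (W : sG) :
  W *m (\sum_W' k W' *: P W') = k W *: (W : 'M_n).
  rewrite mulmx_sumr (bigD1 W) //= big1 ?addr0; last first.
    by move=> W' neW; rewrite -scalemxAr PW (negPf neW) scaler0.
  by rewrite -scalemxAr PW eqxx.
have <- : \dim <<[seq P W | W : sG]>>%VS = #|sG|.
  apply: dim_span_image => k k0 W _; have := sumP k W.
  rewrite k0 mulmx0 => /esym/eqP; rewrite scaler_eq0 (negPf (nz_socle _)) orbF.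
  by move/eqP.
congr (\dim _).
apply/eqP; rewrite eqEsubv; apply/andP; split.
  by apply/span_subvP => _ /imageP[W _ ->].
apply/subvP => c Ec.
have aP (W : sG) : exists a : F, W *m c == a *: (W : 'M_n).
  by have [a ea] := component_eigenvalue (socle_simple W) Ec; exists a;
    apply/eqP.
pose a (W : sG) := xchoose (aP W).
have -> : c = \sum_W a W *: P W.
  apply/eqP; rewrite -subr_eq0 -[_ - _]mul1mx; apply/eqP/sub_kermxP.
  apply: submx_trans soc1 _; apply/sumsmx_subP => W _; apply/sub_kermxP.
  by rewrite mulmxBr sumP (eqP (xchooseP (aP W))) subrr.
apply: memv_suml => W _; apply: memvZ; apply: memv_span; exact: image_f.
Qed.

End CommutativeCentralizer.

Section SubmoduleOfMultiplicityFree.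
Variables (F : closedFieldType) (gT : finGroupType) (G : {group gT}) (n : nat).
Variables (rG : mx_representation F G n) (E : {vspace 'M[F]_n}).
Hypothesis F'G : #|G|%:R != 0 :> F.
Hypothesis memE : forall c, reflect {in G, forall g, c *m rG g = rG g *m c}
  (c \in E).
Hypothesis commE : {in E &, forall c d, c *m d = d *m c}.

(** Compression to [W] maps [E] onto the centralizer of the submodule, which is again commutative.
    The elements of [E] that it kills are those with [c *m P = 0], and rank-nullity gives the
    count. *)
Lemma card_socle_submod (W P : 'M_n) (modW : mxmodule rG W)
    (sG : socleType (submod_repr modW)) (Z : {vspace 'M[F]_n}) :
    P \in E -> (P <= W)%MS -> W *m P = W ->
    (forall c, c \in E -> (c \in Z) = (c *m P == 0)) ->
  (\dim (E :&: Z) + #|sG|)%N = \dim E.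
Proof.
move=> EP sPW WP memZ.
have sWP k (M : 'M_(k, n)) : (M <= W)%MS -> M *m P = M.
  by case/submxP=> M' ->; rewrite -mulmxA WP.
(* [B] is the inclusion of [W] and [D] is [P] read in coordinates on [W]. *)
pose B := val_submod (1%:M : 'M_(\rank W)); pose D := in_submod W P.
have BP : B *m P = B by apply: sWP; apply: val_submodP.
have BD : B *m D = 1%:M.
  transitivity (in_submod W (B *m P)); first exact: mulmxA.
  by rewrite BP val_submodK.
have DB : D *m B = P by rewrite -val_submodE in_submodK.
have DJ g : g \in G -> rG g *m D = D *m submod_repr modW g.
  move=> Gg; rewrite -(in_submodJ modW) // (memE _ EP) //; exact: mulmxA.
have BJ g : g \in G -> submod_repr modW g *m B = B *m rG g.
  by move=> Gg; rewrite -(val_submodJ modW) // mul1mx -val_submodE.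
clearbody B D.
pose phi : 'Hom('M[F]_n, 'M[F]_(\rank W)) := linfun (mulmxr D \o mulmx B).
have phiE c : phi c = B *m c *m D by rewrite lfunE.
have memphi c : reflect {in G, forall g,
    c *m submod_repr modW g = submod_repr modW g *m c} (c \in (phi @: E)%VS).
  apply: (iffP idP) => [/memv_imgP[d Ed ->] g Gg|cc].
    move: (submod_repr modW g) (DJ g Gg) (BJ g Gg) => rWg DJg BJg.
    rewrite phiE -!mulmxA -DJg (mulmxA d) (memE _ Ed) // -(mulmxA (rG g)).
    by rewrite (mulmxA B (rG g)) -BJg -mulmxA.
  (* An endomorphism of [W] is extended by zero on the kernel of [P]. *)
  apply/memv_imgP; exists (D *m c *m B).
    apply/memE => g Gg; move: (submod_repr modW g) (DJ g Gg) (BJ g Gg)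
      (cc g Gg).
    move=> rWg DJg BJg ccg; rewrite -(mulmxA _ B) -BJg !mulmxA DJg.
    by rewrite -(mulmxA D c) ccg !mulmxA.
  by rewrite phiE !mulmxA BD mul1mx -mulmxA BD mulmx1.
rewrite (card_socle_dim _ memphi).
- rewrite -(limg_ker_dim phi E); congr (\dim _ + _)%N.
  apply/vspaceP => c; rewrite !memv_cap; have [Ec /=|//] := boolP (c \in E).
  rewrite memZ // memv_ker phiE; apply/eqP/eqP => [cP0|BcD].
    by rewrite -BP -(mulmxA B P) (commE EP Ec) cP0 mulmx0 mul0mx.
  have : D *m (B *m c *m D) *m B = 0 by rewrite BcD mulmx0 mul0mx.
  rewrite -!mulmxA DB mulmxA DB mulmxA (commE EP Ec) -mulmxA.
  by rewrite (sWP _ P sPW).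
- by apply: mx_Maschke_pchar; rewrite /pgroup.pgroup GRing.pcharf'_nat.
move=> _ _ /memv_imgP[c Ec ->] /memv_imgP[d Ed ->]; rewrite !phiE.
(* [phi] is multiplicative on [E]: the inner factor [D *m B = P] moves past [c1] and is absorbed by
   [B]. *)
have phiM c1 c2 : c1 \in E -> c2 \in E ->
    B *m c1 *m D *m (B *m c2 *m D) = B *m (c1 *m c2) *m D.
  move=> E1 E2; rewrite -!mulmxA (mulmxA D B) DB (mulmxA c1 P) -(commE EP E1).
  by rewrite !mulmxA BP.
by rewrite !phiM // (commE Ec Ed).
Qed.

End SubmoduleOfMultiplicityFree.

(** * The rings R and A *)

Section Ideals.
Variable R : finComNzRingType.

Lemma pideal_ideal (r : R) : is_ideal (pideal r).
Proof.
apply/andP; split; first by apply/imsetP; exists 0; rewrite ?mul0r.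
apply/forallP => a; apply/forall_inP => _ /imsetP[u _ ->].
apply/forall_inP => _ /imsetP[v _ ->]; apply/imsetP; exists (a * u + v) => //.
by ring.
Qed.

Lemma ideal_exp_sub (x : R) k : ideal_exp (pideal x) k \subset pideal (x ^+ k).
Proof.
elim: k => [|k IHk]; first by apply/subsetP => a _; apply/imsetP; exists a;
  rewrite ?mulr1.
apply/bigcap_inf; rewrite pideal_ideal;
  apply/subsetP => _ /imset2P[_ b /imsetP[a _ ->] kb ->].
have /imsetP[c _ ->] := subsetP IHk _ kb; apply/imsetP; exists (a * c) => //.
by rewrite exprS; ring.
Qed.

Lemma nilpotent_generator_neq0 (x : R) l :
  nilpotency_degree (pideal x) l -> (0 < l)%N -> x ^+ l.-1 != 0.
Proof.
case: l => // l [_ minl] _; apply/eqP => x0; apply: (minl l (ltnSn l)).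
apply/setP => a; apply/idP/set1P => [|->].
  move/(subsetP (ideal_exp_sub _ _)) => /imsetP[b _ ->].
  by rewrite x0 mulr0.
by rewrite -[0]x0 mem_ideal_exp_pideal.
Qed.

Lemma local_unit (x r : R) :
  local_ring (pideal x) -> r \in pideal x \/ exists s, r * s = 1.
Proof.
move=> locR; have [|] := boolP (1 \in pideal r).
  by case/imsetP=> s _ e1; right; exists s; rewrite mulrC.
move=> nr1; left.
have [|J maxJ sJ] := maxset_exists (P := fun I => is_ideal I && (I != [set: R]))
  (C := pideal r).
  rewrite pideal_ideal; apply: contra nr1 => /eqP ->; exact: in_setT.
move: (locR J); rewrite /maximal_ideal maxJ => /esym/eqP <-.
by apply: (subsetP sJ); apply/imsetP; exists 1; rewrite ?mul1r.
Qed.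

Lemma odd_pchar_half p : odd p -> p \in [pchar R] -> exists k : R, k * 2 = 1.
Proof.
move=> podd /andP[_ /eqP p0]; exists (p.+1./2)%:R.
by rewrite -natrM muln2 halfK /= podd /= subn0 -addn1 natrD p0 add0r.
Qed.

End Ideals.

Section RamifiedRing.
Variables (R : finComNzRingType) (x : R).
Local Notation A := (ramified_ext x).
Local Notation y := (ramY x).
Implicit Types a b : A.

Lemma ram0_0 : ram0 (0 : A) = 0. Proof. exact: coef0. Qed.
Lemma ram1_0 : ram1 (0 : A) = 0. Proof. exact: coef0. Qed.

Definition ramE := (ram0_0, ram1_0, ram0D, ram1D, ram0N, ram1N, conjA0, conjA1,
  ramM, ram0Y, ram1Y, ram0C, ram1C).

Lemma conjA_mul a b : conjA (a * b) = conjA a * conjA b.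
Proof. by apply: ramP; rewrite !ramE; ring. Qed.

Lemma conjAK a : conjA (conjA a) = a.
Proof. by apply: ramP; rewrite !ramE ?opprK. Qed.

Lemma conjA_Y : conjA y = - y.
Proof. by apply: ramP; rewrite !ramE ?oppr0. Qed.

Lemma conjA_0 : conjA (0 : A) = 0.
Proof. by apply: ramP; rewrite !ramE ?oppr0. Qed.

Lemma conjA_1 : conjA (1 : A) = 1.
Proof. by rewrite -[LHS]mul1r -{1}[1]conjAK -conjA_mul mulr1 conjAK. Qed.

Lemma conjA_opp a : conjA (- a) = - conjA a.
Proof. by apply: ramP; rewrite !ramE. Qed.

(** For a = r + s y the difference a* - a is -2 s y: the involution is trivial on the residue
    field. *)
Lemma conjA_subY a : exists b, conjA a = a + y * b.
Proof.
by exists (ramC x (- ram1 a *+ 2)); apply: ramP; rewrite !ramE; ring.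
Qed.

Definition unitA a : Prop := exists b, a * b = 1.

Lemma unitA_mul a b : unitA a -> unitA b -> unitA (a * b).
Proof.
case=> a' ea [b' eb]; exists (a' * b').
by rewrite mulrACA ea eb mulr1.
Qed.

Lemma ramC_1 : ramC x 1 = 1.
Proof. by rewrite /ramC rmorph1. Qed.

Hypothesis locR : local_ring (pideal x).

(** Let a = r + s y. If x divides r, then y divides a. Otherwise r is a unit, hence so is the norm a
    a* = r^2 - x s^2, and a* divided by the norm inverts a. *)
Lemma ram_local a : unitA a \/ exists b, a = y * b.
Proof.
have [/imsetP[r _ ea]|[s es]] := local_unit (ram0 a) locR; [right|].
  by exists (ramC x (ram1 a) + ramC x r * y); apply: ramP; rewrite !ramE ?ea;
    ring.
have [/imsetP[r _ ex]|[t et]] := local_unit (ram0 a ^+ 2 - x * ram1 a ^+ 2)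
  locR; last first.
  left; exists (ramC x t * conjA a); rewrite -ramC_1; apply: ramP;
    rewrite !ramE.
    by rewrite -et; ring.
  by ring.
(* Here r is a unit while the norm lies in (x); then r^2, and with it r, lies in (x), so y divides a
   as in the first case. *)
right; have e1 : ram0 a = x * ((r + ram1 a ^+ 2) * s).
  by rewrite -[LHS]mulr1 -es mulrA -expr2
    -(subrK (x * ram1 a ^+ 2) (ram0 a ^+ 2)) ex; ring.
exists (ramC x (ram1 a) + ramC x ((r + ram1 a ^+ 2) * s) * y).
by apply: ramP; rewrite !ramE ?e1; ring.
Qed.

Variable l : nat.
Hypotheses (l_gt0 : (0 < l)%N) (nilM : nilpotency_degree (pideal x) l).

Lemma ramY_ll : y ^+ (l + l) = 0.
Proof. exact: ramY_nilp (nilpotent_generator nilM). Qed.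

(** The highest power in question is y^(2l-1) = x^(l-1) y, and x^(l-1) is non-zero by minimality of
    l. *)
Lemma ramY_neq0 k : (k < l + l)%N -> y ^+ k != 0.
Proof.
move=> ltk; have : y ^+ (l + l).-1 != 0.
  have -> : (l + l).-1 = (l.-1 * 2).+1 by rewrite -(prednK l_gt0) /=
    addnS addnn muln2.
  rewrite exprSr mulnC exprM ramY2 /ramC -rmorphXn -/(ramC x _).
  apply: contra (nilpotent_generator_neq0 nilM l_gt0) =>
    /eqP/(congr1 (@ram1 R x)).
  by rewrite !ramE mulr1 mul0r addr0 => ->.
apply: contra => /eqP k0;
  have lek : (k <= (l + l).-1)%N by rewrite -ltnS prednK ?addn_gt0 ?l_gt0.
by rewrite -(subnKC lek) exprD k0 mul0r.
Qed.

Lemma unitA_notY a b : unitA a -> a <> y * b.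
Proof.
have l2 : (0 < l + l)%N by rewrite addn_gt0 l_gt0.
move=> [c ac] ab; have /eqP[] : y ^+ (l + l).-1 != 0 by apply: ramY_neq0;
  rewrite prednK.
by rewrite -[LHS]mulr1 -ac ab !mulrA -exprSr prednK // ramY_ll !mul0r.
Qed.

(** Factors y are split off one at a time: if a = y^j b with j < 2l - k, then a unit b would give
    y^(k+j) = 0 with k + j < 2l. *)
Lemma ram_annihilator k a :
  (k <= l + l)%N -> y ^+ k * a = 0 -> exists b, a = y ^+ (l + l - k) * b.
Proof.
move=> lek ka; have: (l + l - k <= l + l - k)%N by [].
elim: {-2}(l + l - k)%N => [|j IHj] ltj; first by exists a; rewrite expr0 mul1r.
have [b ab] := IHj (ltnW ltj); have [[c bc]|[c bc]] := ram_local b; last first.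
  by exists c; rewrite exprSr -mulrA -bc.
have /eqP[] : y ^+ (k + j) != 0 by apply: ramY_neq0; rewrite -ltn_subRL.
by rewrite -[LHS]mulr1 -bc mulrA exprD -(mulrA _ _ b) -ab ka mul0r.
Qed.

Lemma unitA_addY a b : unitA a -> unitA (a + y * b).
Proof.
move=> ua; have [//|[c e]] := ram_local (a + y * b).
by case: (unitA_notY (b := c - b) ua); rewrite mulrBr -e addrK.
Qed.

Section Character.
Variables (C : fieldType) (lam : R -> C).
Hypotheses (two : exists k : R, k * 2 = 1) (plam : primitive_char lam).

(** The values [dA (a * b)] form an ideal on which [lam] is trivial, so they vanish. As 2 is
    invertible, [ram1] vanishes at [b] and at [y * b], and these values are the two coordinates of
    [b]. *)
Lemma mu_primitive b : (forall a, mu lam (a * b) = 1) -> b = 0.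
Proof.
move=> mu1; have [k k2] := two; pose I := [set dA (a * b) | a : A].
have dAC r a : dA (ramC x r * a) = r * dA a by rewrite /dA !ramE; ring.
have I0 : I = [set 0].
  apply: plam => [|_ /imsetP[a _ ->]]; last exact: mu1.
  apply/andP; split; first by apply/imsetP; exists 0;
    rewrite ?mul0r // dA_conj // conjA_0.
  apply/forallP => r; apply/forall_inP => _ /imsetP[a _ ->].
  apply/forall_inP => _ /imsetP[c _ ->]; apply/imsetP;
    exists (ramC x r * a + c) => //.
  by rewrite mulrDl -mulrA dAD dAC.
have b1 a : ram1 (a * b) = 0.
  have : dA (a * b) \in I by apply: imset_f.
  by rewrite I0 => /set1P d0;
    rewrite -[LHS]mul1r -k2 -mulrA mulr_natl -/(dA _) d0 mulr0.
apply: ramP; last by rewrite ram1_0 -[b]mul1r b1.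
by have := b1 y; rewrite !ramE mul0r mul1r add0r.
Qed.

Lemma mu_primitive2 b : (forall a, mu lam (a * b + a * b) = 1) -> b = 0.
Proof.
move=> mu1; have [k k2] := two; apply: mu_primitive => a.
have -> : a * b = (ramC x k * a) * b + (ramC x k * a) * b; last exact: mu1.
rewrite -mulrDl -mulrDl -[a in LHS]mul1r; congr (_ * _ * _).
by rewrite -ramC_1 -k2 mulr_natr /ramC rmorphMn mulr2n.
Qed.

End Character.

End RamifiedRing.

(** * Hermitian geometry *)

Section Hermitian.
Variables (R : finComNzRingType) (x : R).
Local Notation A := (ramified_ext x).
Local Notation y := (ramY x).
Variables (V : finLmodType A) (h : V -> V -> A).
Hypothesis hermh : hermitian_form h.
Implicit Types u v w : V.

Lemma herm_conj u v : h v u = conjA (h u v).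
Proof. exact: Defs.hermC hermh u v. Qed.

Lemma herm0r u : h u 0 = 0.
Proof. by rewrite -(scale0r u) (hermZr hermh) mul0r. Qed.

Lemma hermNr u v : h u (- v) = - h u v.
Proof. by rewrite -scaleN1r (hermZr hermh) mulN1r. Qed.

Lemma hermBr u v w : h u (v - w) = h u v - h u w.
Proof. by rewrite (hermDr hermh) hermNr. Qed.

Lemma hermZl a u v : h (a *: u) v = conjA a * h u v.
Proof.
by rewrite herm_conj (hermZr hermh) conjA_mul -herm_conj.
Qed.

Lemma herm0l u : h 0 u = 0.
Proof. by rewrite herm_conj herm0r conjA_0. Qed.

Lemma hermNl u v : h (- u) v = - h u v.
Proof. by rewrite herm_conj hermNr conjA_opp -herm_conj. Qed.

Lemma hermBl u v w : h (u - v) w = h u w - h v w.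
Proof. by rewrite (hermDl hermh) hermNl. Qed.

Lemma herm_sumr (I : Type) (r : seq I) (P : pred I) (F : I -> V) u :
  h u (\sum_(i <- r | P i) F i) = \sum_(i <- r | P i) h u (F i).
Proof. exact: (big_morph (h u) (hermDr hermh u) (herm0r u)). Qed.

Lemma herm_suml (I : Type) (r : seq I) (P : pred I) (F : I -> V) u :
  h (\sum_(i <- r | P i) F i) u = \sum_(i <- r | P i) h (F i) u.
Proof.
exact: (big_morph (h^~ u) (fun v w => hermDl hermh v w u) (herm0l u)).
Qed.

Lemma herm_selfC u : conjA (h u u) = h u u.
Proof. by rewrite -herm_conj. Qed.

Lemma conjA_inv (a b : A) : conjA a = a -> a * b = 1 -> conjA b = b.
Proof.
move=> ea ab; have ab' : a * conjA b = 1.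
  by rewrite -{1}ea -conjA_mul ab conjA_1.
by rewrite -[LHS]mul1r -ab mulrAC ab' mul1r.
Qed.

Hypothesis ndh : nondegenerate_form h.

Lemma nondeg_eq0 v : (forall u, h u v = 0) -> v = 0.
Proof.
move=> v0; have [w [_ uw]] := ndh (\0 : {scalar V}).
have <- : w = v by apply: uw => u; rewrite herm_conj v0 conjA_0.
by apply: uw => u; rewrite herm0l.
Qed.

Lemma isometry_unitary (f : V -> V) :
  linear f -> (forall u v, h (f u) (f v) = h u v) ->
  exists2 g, g \in unitary h & g =1 f.
Proof.
move=> lf hf; have f_inj : injective f.
  move=> u v euv; apply/eqP; rewrite -subr_eq0; apply/eqP.
  apply: nondeg_eq0 => w; rewrite -hf addrC -scaleN1r lf euv scaleN1r addNr.
  exact: herm0r.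
exists (perm f_inj) => [|u]; last by rewrite permE.
by apply/unitaryP; split=> [a u v|u v]; rewrite !permE ?lf ?hf.
Qed.

Lemma unitary_opp : exists2 g, g \in unitary h & forall v, g v = - v.
Proof.
have [g Ug eg] : exists2 g, g \in unitary h & g =1 (fun v => - v).
  apply: isometry_unitary => [a u v|u v]; first by rewrite opprD scalerN.
  by rewrite hermNr hermNl opprK.
by exists g.
Qed.

(* The map z |-> z - h(u, z) c u, where c is the inverse of h(u, v), is
   isometric because h(u, u) = h(u, v) + h(u, v)^*. *)
Lemma unitary_reflection v w :
    h v v = h w w -> unitA (h (v - w) v) ->
  exists2 g, g \in unitary h & g v = w.
Proof.
set u := v - w => evw [c huvc]; have eu : u = v - w by [].
have huu : h u u = h u v + conjA (h u v).
  by rewrite -herm_conj /u !(hermBr, hermBl) -evw; ring.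
clearbody u; have huvc' : conjA (h u v) * conjA c = 1.
  by rewrite -conjA_mul huvc conjA_1.
have [g Ug eg] : exists2 g, g \in unitary h &
  g =1 (fun z => z - (h u z * c) *: u).
  apply: isometry_unitary => [a z1 z2|z1 z2].
    rewrite /= (hermDr hermh) (hermZr hermh) mulrDl scalerDl scalerBr scalerA.
    by rewrite mulrA opprD addrACA.
  rewrite !hermBr !hermBl !(hermZr hermh) !hermZl !conjA_mul huu
    (herm_conj u z1).
  set p := h u z2; set q := h u z1; set d := h u v in huvc huvc' *.
  have e : conjA q * conjA c * (d + conjA d) * (p * c) =
    conjA q * p * (c + conjA c).
    transitivity (conjA q * p * (conjA c * (d * c) + c * (conjA d * conjA c)));
      first by ring.
    by rewrite huvc huvc'; ring.
  transitivity (h z1 z2 - p * c * conjA q - conjA q * conjA c * p + conjA q *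
    conjA c * (d + conjA d) * (p * c)); first by ring.
  by rewrite e; ring.
by exists g; rewrite // eg huvc scale1r eu opprB addrC subrK.
Qed.

Hypotheses (locR : local_ring (pideal x)) (two : exists k : R, k * 2 = 1).
Variable l : nat.
Hypotheses (l_gt0 : (0 < l)%N) (nilM : nilpotency_degree (pideal x) l).
Variable m : nat.
Hypothesis freeV : free_of_rank V m.

Lemma yV_annihilator k v :
  (k <= l + l)%N -> y ^+ k *: v = 0 -> v \in yV V (l + l - k).
Proof.
have [b] := freeV; set F := fun c : 'rV_m => _ => -[f fK Kf] lek kv0.
have FZ a c : a *: F c = F (a *: c).
  by rewrite /F scaler_sumr; apply: eq_bigr => i _; rewrite mxE scalerA.
have F0 : F 0 = 0 by apply: big1 => i _; rewrite mxE scale0r.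
have c0 i : y ^+ k * f v 0 i = 0.
  have : y ^+ k *: f v = 0 by rewrite -[LHS]fK -FZ Kf kv0 -{1}F0 fK.
  by move/rowP/(_ i); rewrite !mxE.
have cP i : exists d, f v 0 i == y ^+ (l + l - k) * d.
  by have [d ->] := ram_annihilator locR l_gt0 nilM lek (c0 i); exists d.
pose d := \row_i xchoose (cP i).
apply/yVP; exists (F d); rewrite FZ -[LHS]Kf; congr F.
by apply/rowP => i; rewrite !mxE; apply/eqP/(xchooseP (cP i)).
Qed.

Lemma yV_iff k v : (k <= l + l)%N ->
  (v \in yV V (l + l - k)) = (y ^+ k *: v == 0).
Proof.
move=> lek; apply/idP/eqP => [/yVP[u ->]|]; last exact: yV_annihilator.
by rewrite scalerA -exprD subnKC // (ramY_ll nilM) scale0r.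
Qed.

(** The vector y^(2l-k) v is orthogonal to all of V, hence zero. *)
Lemma yV_herm k v : (k <= l + l)%N ->
  (forall u, exists b, h u v = y ^+ k * b) -> v \in yV V k.
Proof.
move=> lek hv; rewrite -(subKn lek) yV_iff ?leq_subr //; apply/eqP.
apply: nondeg_eq0 => u; have [b e] := hv u.
by rewrite (hermZr hermh) e mulrA -exprD subnK // (ramY_ll nilM) mul0r.
Qed.

Let orthoS (S : {set V}) :=
  [forall u in S, exists b, h u u * b == 1]
  && [forall u in S, forall v in S, (u != v) ==> (h u v == 0)].

(** Take a maximal orthogonal set of vectors with h(u, u) invertible. By maximality and
    polarization, [h] takes values in yA on its orthogonal complement, so non-degeneracy puts the
    complement inside yV. Dividing by y and repeating, the complement is zero because y^(2l) = 0. *)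
Lemma orthogonal_set : exists S : {set V}, exists d : V -> A,
  [/\ {in S, forall u, h u u * d u = 1},
      {in S &, forall u v, u != v -> h u v = 0} &
      forall v, v = \sum_(u in S) (d u * h u v) *: u].
Proof.
have o0 : orthoS set0 by apply/andP; split; apply/forall_inP => u; rewrite inE.
have [S /maxsetP[oS maxS] _] := maxset_exists o0.
have [/forall_inP uS /forall_inP oSS] := andP oS.
pose d u := odflt 0 [pick b | h u u * b == 1].
have dS : {in S, forall u, h u u * d u = 1}.
  move=> u /uS/existsP[b eb]; rewrite /d; case: pickP => [c /eqP//|/(_ b)].
  by rewrite eb.
have hS : {in S &, forall u v, u != v -> h u v = 0}.
  by move=> u v uu vv neq; have /forall_inP/(_ v vv)/implyP/(_ neq)/eqP :=
    oSS u uu.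
exists S, d; split=> // v.
pose pr v := v - \sum_(u in S) (d u * h u v) *: u.
pose perp w := forall u, u \in S -> h u w = 0.
have prZ a w : pr (a *: w) = a *: pr w.
  rewrite /pr scalerBr scaler_sumr; congr (_ - _); apply: eq_bigr => u _.
  by rewrite (hermZr hermh) scalerA mulrCA.
have pr_perp w : perp (pr w).
  move=> u uu; rewrite hermBr herm_sumr (bigD1 u) //= big1 =>
    [|t /andP[tt neq]].
    by rewrite (hermZr hermh) mulrAC -mulrA mulrCA mulrA dS // mul1r addr0
      subrr.
  by rewrite (hermZr hermh) (hS u t) ?mulr0 // eq_sym.
have pr_id w : perp w -> pr w = w.
  by move=> pw; rewrite /pr big1 ?subr0 // => u uu; rewrite pw // mulr0 scale0r.
have perp_self w : perp w -> exists b, h w w = y * b.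
  move=> pw; have [[b wb]|//] := ram_local locR (h w w).
  (* If h(w, w) is a unit, then w could be added to S; by maximality it is already in S, and being
     orthogonal to S it is orthogonal to itself. *)
  have wS : w \in S.
    suff -> : S = w |: S by rewrite setU11.
    apply/esym/maxS; last exact: subsetU1.
    apply/andP; split.
      apply/forall_inP => u /setU1P[->|uu]; last exact: uS.
      by apply/existsP; exists b; rewrite wb.
    apply/forall_inP => u /setU1P[->|uu]; apply/forall_inP => t /setU1P[->|tt].
    - by rewrite eqxx.
    - by rewrite herm_conj pw // conjA_0 eqxx implybT.
    - by rewrite pw // eqxx implybT.
    - by apply/implyP => neq; rewrite hS.
  by exists 0; rewrite pw // mulr0.
have perpD w1 w2 : perp w1 -> perp w2 -> perp (w1 + w2).
  by move=> p1 p2 u uu; rewrite (hermDr hermh) p1 // p2 // addr0.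
have perp_herm w1 w2 : perp w1 -> perp w2 -> exists b, h w1 w2 = y * b.
  (* Polarization: h(w2, w1) agrees with h(w1, w2) modulo y, so 2 h(w1, w2) is determined modulo y
     by three values h(w, w), all in yA. *)
  move=> p1 p2; have [uni|//] := ram_local locR (h w1 w2).
  have [b1 e1] := perp_self _ p1; have [b2 e2] := perp_self _ p2.
  have [b3 e3] := perp_self _ (perpD _ _ p1 p2).
  have [b4 e4] := conjA_subY (h w1 w2).
  have [k k2] := two; case:
    (unitA_notY l_gt0 nilM (b := (b3 - b1 - b2 - b4) * ramC x k) uni).
  have k2' : 2 * ramC x k = 1 by rewrite mulr_natl -ramC_1 -k2 mulr_natr /ramC
    rmorphMn.
  rewrite -[LHS]mulr1 -k2' !mulrA; congr (_ * _).
  rewrite !mulrBr -e3 -e1 -e2 !(hermDl hermh) !(hermDr hermh) (herm_conj w1 w2)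
    e4.
  by ring.
have perp_Y w : perp w -> exists w', w = y *: w'.
  move=> pw; have /yVP[w' ->] : w \in yV V 1; last by exists w'; rewrite expr1.
  apply: yV_herm => [|u]; first by rewrite addn_gt0 l_gt0.
  have [b e] := perp_herm _ _ (pr_perp u) pw; exists b; rewrite expr1 -e.
  rewrite hermBl herm_suml big1 ?subr0 // => t tt.
  by rewrite hermZl pw ?mulr0.
have perp_Yk k : exists w, perp w /\ pr v = y ^+ k *: w.
  elim: k => [|k [w [pw ew]]]; first by exists (pr v); rewrite expr0 scale1r.
  (* The quotient w' need not be orthogonal to S, but projecting it leaves y w' unchanged, since
     [pr] commutes with scalars and fixes w. *)
  have [w' ew'] := perp_Y _ pw; exists (pr w'); split; first exact: pr_perp.
  by rewrite ew exprSr -scalerA -prZ -ew' pr_id.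
have [w [_ ew]] := perp_Yk (l + l)%N; apply/eqP; rewrite -subr_eq0 -/(pr v) ew.
by rewrite (ramY_ll nilM) scale0r.
Qed.

Lemma unitaryZ (g : {perm V}) a v : g \in unitary h -> g (a *: v) = a *: g v.
Proof.
case/unitaryP=> lg _; have g0 : g 0 = 0 by have := lg (-1) 0 0;
  rewrite scaler0 addr0 scaleN1r addNr.
by rewrite -[a *: v]addr0 lg g0 addr0.
Qed.

Lemma primitive_decomposition v :
  v = 0 \/ exists k, exists2 v0, v0 \notin yV V 1 & v = y ^+ k *: v0.
Proof.
have step k : (exists k, exists2 v0, v0 \notin yV V 1 & v = y ^+ k *: v0)
    \/ exists w, v = y ^+ k *: w.
  elim: k => [|k [|[w ew]]]; [by right; exists v; rewrite scale1r | by left |].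
  have [/yVP[w' ew']|nw] := boolP (w \in yV V 1); last by left; exists k, w.
  by right; exists w'; rewrite ew ew' scalerA -exprD addn1.
have [|[w ->]] := step (l + l)%N; first by right.
by left; rewrite (ramY_ll nilM) scale0r.
Qed.

Lemma unitA_2 : @unitA R x 2.
Proof.
have [k k2] := two; exists (ramC x k).
by rewrite mulr_natl -ramC_1 -k2 mulr_natr /ramC rmorphMn.
Qed.

Lemma unitA_conj (a : A) : unitA a -> unitA (conjA a).
Proof. by case=> b ab; exists (conjA b); rewrite -conjA_mul ab conjA_1. Qed.

(* In coordinates on an orthogonal basis, sigma conjugates every coordinate.
   As sigma v = v mod y, unitary_reflection does not apply to v and sigma v; but
   if h(u, u) and h(u, v) are units, it applies to v' and sigma v, where v' is
   the image of v under the reflection in u. *)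
Lemma semilinear_involution : exists sigma : V -> V,
  [/\ involutive sigma, {morph sigma : u v / u + v},
      forall u v, h (sigma u) (sigma v) = h v u &
      forall v, sigma v \in orbit 'P (unitary h) v].
Proof.
have [S [d [dS hS defV]]] := orthogonal_set.
pose vec c := \sum_(u in S) (d u * c u) *: u.
have h_vec c u : u \in S -> h u (vec c) = c u.
  move=> uu; rewrite herm_sumr (bigD1 u) //= big1 => [|t /andP[tt neq]].
    by rewrite (hermZr hermh) mulrAC (mulrC (d u)) dS // mul1r addr0.
  by rewrite (hermZr hermh) (hS u t) ?mulr0 // eq_sym.
pose sg v := vec (fun u => conjA (h u v)).
have conj_d u : u \in S -> conjA (d u) = d u.
  by move=> uu; apply: conjA_inv (dS u uu); apply: herm_selfC.
have sgZ a v : sg (a *: v) = conjA a *: sg v.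
  rewrite scaler_sumr; apply: eq_bigr => u _.
  by rewrite (hermZr hermh) conjA_mul scalerA mulrCA.
have sgK : involutive sg.
  move=> v; rewrite [RHS]defV; apply: eq_bigr => u uu.
  by rewrite h_vec // conjAK.
have sg_herm u v : h (sg u) (sg v) = h v u.
  rewrite [v in RHS]defV !herm_suml; apply: eq_bigr => t tt.
  by rewrite !hermZl h_vec // !conjA_mul conjAK conj_d //; ring.
have sgY v : exists b, sg v = v + y *: b.
  have /yVP[b eb] : sg v - v \in yV V 1; last by exists b;
    rewrite -[y]expr1 -eb addrC subrK.
  rewrite [v in _ - v]defV -sumrB; apply: (big_ind (fun z => z \in yV V 1)).
  - exact: yV0.
  - exact: yVD.
  move=> u _; have [b ->] := conjA_subY (h u v); apply/yVP;
    exists ((d u * b) *: u).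
  by rewrite -scalerBl scalerA expr1; congr (_ *: _); ring.
have sg_prim v : v \notin yV V 1 -> exists2 g, g \in unitary h & g v = sg v.
  (* If no h(u, v) were a unit, y would divide every coefficient in the orthogonal expansion of
     v. *)
  move=> prim_v; have [u uu uni] : exists2 u, u \in S & unitA (h u v).
    have [/exists_inP[u uu /existsP[b /eqP hb]]|] :=
      boolP [exists u in S, [exists b, h u v * b == 1]];
        first by exists u => //; exists b.
    rewrite negb_exists_in => /forall_inP noU; case/negP: prim_v.
    rewrite [v]defV; apply: (big_ind (fun z => z \in yV V 1));
      [exact: yV0|exact: yVD|].
    move=> u uu; have [[b hb]|[b ->]] := ram_local locR (h u v).
      by case/existsP: (noU u uu); exists b; apply/eqP.
    by apply/yVP; exists ((d u * b) *: u); rewrite scalerA expr1;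
      congr (_ *: _); ring.
  set q := h u v in uni; pose c := d u * q; pose v' := v - (2 * c) *: u.
  have cu : c * h u u = q by rewrite mulrAC (mulrC (d u)) dS // mul1r.
  have uni_d : unitA (d u) by exists (h u u); rewrite mulrC dS.
  have uni_c : unitA (2 * c) by apply: unitA_mul;
    [exact: unitA_2 | exact: unitA_mul].
  have conj_c : conjA c = d u * conjA q by rewrite conjA_mul conj_d.
  have conj_2c : conjA (2 * c) = 2 * conjA c by rewrite !mulr_natl !mulr2n
    conjAD.
  have hv'v' : h v v = h v' v'.
    rewrite /v' hermBr !hermBl !(hermZr hermh) !hermZl -/q (herm_conj u v) -/q
      conj_2c.
    transitivity (h v v - 2 * c * conjA q - 2 * conjA c * q + 4 * conjA c *
      (c * h u u)); last by ring.
    by rewrite cu conj_c /c; ring.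
  have [g1 U1 e1] : exists2 g, g \in unitary h & g v = v'.
    apply: unitary_reflection => //;
      rewrite /v' opprB addrCA subrr addr0 hermZl.
    by apply: unitA_mul => //; apply: unitA_conj.
  have huv' : h u v' = - q.
    by rewrite hermBr (hermZr hermh) -mulrA cu -/q; ring.
  have [g2 U2 e2] : exists2 g, g \in unitary h & g v' = sg v.
    apply: unitary_reflection; first by rewrite -hv'v' sg_herm.
    (* With sigma v = v + y b, the value h(v' - sigma v, v') is 2 c* q modulo y, a unit. *)
    have [b ->] := sgY v.
    have -> : v' - (v + y *: b) = - ((2 * c) *: u) - y *: b.
      by rewrite /v' opprD addrA; congr (_ - _); rewrite addrAC subrr add0r.
    rewrite hermBl hermNl !hermZl huv' mulrN opprK conjA_Y mulNr opprK.
    apply: (unitA_addY locR l_gt0 nilM); apply: unitA_mul => //.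
    exact: unitA_conj.
  by exists (g1 * g2)%g; rewrite ?groupM // permM e1.
exists sg; split=> // [u v|v].
  rewrite -big_split; apply: eq_bigr => t _.
  by rewrite (hermDr hermh) conjAD mulrDr scalerDl.
apply/orbitP; have [v0|[k [v0 /sg_prim[g Ug eg] ->]]] :=
  primitive_decomposition v.
  exists 1%g; rewrite ?group1 //= apermE perm1 v0.
  by rewrite -[0 in RHS](scale0r 0) sgZ conjA_0 scale0r.
(* sigma(y^k v0) = (-1)^k y^k sigma(v0), and the sign is absorbed by -1 in U. *)
rewrite sgZ -[y ^+ k]mulr1 conjA_Xn conjA_1 mulr1 -signr_odd.
case: (odd k); last by exists g; rewrite //= apermE unitaryZ // eg expr0 mul1r.
have [g' Ug' eg'] := unitary_opp; exists (g * g')%g; first exact: groupM.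
by rewrite /= apermE permM unitaryZ // eg eg' expr1 mulN1r scaleNr.
Qed.

End Hermitian.

(** * Heisenberg operators *)

Section Heisenberg.
Variables (C : numClosedFieldType) (R : finComNzRingType) (x : R).
Local Notation A := (ramified_ext x).
Local Notation y := (ramY x).
Variables (V : finLmodType A) (h : V -> V -> A).
Variables (lam : R -> C) (l : nat) (T : {set V}).
Hypotheses (hermh : hermitian_form h) (ndh : nondegenerate_form h).
Hypotheses (locR : local_ring (pideal x)) (two : exists k : R, k * 2 = 1).
Hypotheses (l_gt0 : (0 < l)%N) (nilM : nilpotency_degree (pideal x) l).
Variable m : nat.
Hypothesis freeV : free_of_rank V m.
Hypotheses (lamP : additive_char lam) (plam : primitive_char lam).
Hypothesis trT : transversal_mod T (yV V l).

Local Notation U := (unitary h).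
Local Notation mu := (mu lam).
Local Notation n := #|T|.
Local Notation iV := (yV V l).
Implicit Types u v w : V.

Let t (i : 'I_n) : V := enum_val i.

Let muD (a b : A) : mu (a + b) = mu a * mu b.
Proof. exact: muD. Qed.

Let mu1 (a : A) : conjA a = a -> mu a = 1.
Proof. exact: mu_conj. Qed.

Let mu0 : mu (0 : A) = 1.
Proof. by apply: mu1; apply: conjA_0. Qed.

Let mu_neq0 (a : A) : mu a != 0.
Proof.
by apply: contra_eq_neq (mu0) => z;
  rewrite -(subrr a) muD z mul0r eq_sym oner_neq0.
Qed.

Let muN (a : A) : mu (- a) = (mu a)^-1.
Proof. by apply: (mulfI (mu_neq0 a)); rewrite divff // -muD subrr mu0. Qed.

Let mu_self u : mu (h u u) = 1.
Proof. by apply: mu1; apply: herm_selfC. Qed.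

Let mu_swap u v : mu (h v u) = (mu (h u v))^-1.
Proof.
apply: (mulfI (mu_neq0 (h u v))); rewrite divff //.
by rewrite (mu_hermC hermh lamP).
Qed.

Lemma transversal_rank_exists v : exists i : 'I_n, v - t i \in iV.
Proof. by have [i vi _] := transversal_rank trT v; exists i. Qed.

Definition weil_index v : 'I_n := xchoose (transversal_rank_exists v).

Lemma weil_indexP v : v - t (weil_index v) \in iV.
Proof. exact: xchooseP (transversal_rank_exists v). Qed.

Lemma weil_index_uniq v i : v - t i \in iV -> i = weil_index v.
Proof.
have [k _ uk] := transversal_rank trT v => vi.
by rewrite (uk _ vi) (uk _ (weil_indexP v)).
Qed.

(* The basis vectors e_v, v in T, extended to all v in V by g e_v = e_(g v).
   The lock keeps scalerA from seeing through the definition. *)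
Definition weil_vec v : 'rV[C]_n :=
  locked (mu (h v (t (weil_index v))) *: delta_mx 0 (weil_index v)).

Lemma weil_vec_t i : weil_vec (t i) = delta_mx 0 i.
Proof.
rewrite /weil_vec -lock -(@weil_index_uniq (t i) i) ?mu_self ?scale1r //.
by rewrite subrr yV0.
Qed.

(** For the common representative s, both u - v and v - s lie in iV, on which [h] vanishes. So h(u,
    s) is h(u, v) + h(v, s) up to h(v, v), where [mu] is trivial. *)
Lemma weil_vec_congr u v :
  u - v \in iV -> weil_vec u = mu (h u v) *: weil_vec v.
Proof.
move=> uv; have eti : weil_index u = weil_index v.
  apply/esym/weil_index_uniq; rewrite -(subrK v u) -addrA.
  by apply: yVD => //; apply: weil_indexP.
rewrite /weil_vec -!lock eti scalerA; congr (_ *: _); set s := t _.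
have vs : v - s \in iV := weil_indexP v.
have e0 := herm_iV nilM hermh uv vs.
have -> : h u s = h u v + h v s - h v v - h (u - v) (v - s).
  by rewrite !(hermBl hermh) !(hermBr hermh); ring.
by rewrite e0 subr0 muD muN mu_self invr1 mulr1 muD.
Qed.

Lemma weil_vec_ext (M N : 'M_n) :
  (forall v, weil_vec v *m M = weil_vec v *m N) -> M = N.
Proof.
by move=> eMN; apply/row_matrixP => i; rewrite !rowE -weil_vec_t eMN.
Qed.

(** The rule e_u |-> mu(h(w, u)) e_(u + w) is imposed on the basis only; [weil_vec_heis] extends it
    to all u in V. *)
Definition heis w : 'M[C]_n :=
  \matrix_(i < n) (mu (h w (t i)) *: weil_vec (t i + w)).

Lemma weil_vec_heis u w : weil_vec u *m heis w = mu (h w u) *: weil_vec (u + w).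
Proof.
rewrite {1}/weil_vec -lock -scalemxAl -rowE rowK scalerA; set s := t _.
have us : u + w - (s + w) \in iV by rewrite opprD addrACA subrr addr0
  weil_indexP.
rewrite (weil_vec_congr us) scalerA; congr (_ *: _).
rewrite (hermDl hermh) !(hermDr hermh) !muD mu_self (mu_swap w u).
by field; apply: mu_neq0.
Qed.

Lemma weil_vec_weil g v :
  g \in U -> weil_vec v *m weil_mx h lam l T g = weil_vec (g v).
Proof.
move=> Ug; have [_ hg] := unitaryP _ _ Ug.
rewrite {1}/weil_vec -lock -scalemxAl -rowE; set i := weil_index v.
have -> : row i (weil_mx h lam l T g) = weil_vec (g (t i)).
  apply/rowP => j; rewrite /weil_vec -lock !mxE eqxx /=; set k := weil_index _;
    rewrite -/(t i) -/(t j).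
  case: eqP => [->|/eqP nj]; first by rewrite weil_indexP mulr1.
  by case: ifP => [/weil_index_uniq ej|]; rewrite ?mulr0 //; case/eqP: nj.
have gvi : g v - g (t i) \in iV.
  by rewrite -(unitaryB _ _ Ug) (unitary_yV Ug) // weil_indexP.
by rewrite (weil_vec_congr gvi) hg.
Qed.

Lemma heis0 : heis 0 = 1%:M.
Proof.
apply: weil_vec_ext => v.
by rewrite weil_vec_heis (herm0l hermh) mu0 scale1r addr0 mulmx1.
Qed.

Lemma heis_mul u v : heis u *m heis v = mu (h v u) *: heis (u + v).
Proof.
apply: weil_vec_ext => w; rewrite mulmxA weil_vec_heis -scalemxAl weil_vec_heis.
rewrite -scalemxAr weil_vec_heis !scalerA addrA; congr (_ *: _).
by rewrite (hermDl hermh) (hermDr hermh) !muD; ring.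
Qed.

Lemma heis_weil g w : g \in U ->
  heis w *m weil_mx h lam l T g = weil_mx h lam l T g *m heis (g w).
Proof.
move=> Ug; have [lg hg] := unitaryP _ _ Ug; apply: weil_vec_ext => v.
rewrite !mulmxA weil_vec_heis weil_vec_weil // weil_vec_heis hg.
by rewrite -scalemxAl weil_vec_weil //; have := lg 1 v w;
  rewrite !scale1r => ->.
Qed.

Lemma heis_neq0 w : heis w != 0.
Proof.
apply/eqP => w0; have := heis_mul w (- w); rewrite w0 mul0mx subrr heis0.
move/matrixP/(_ (weil_index 0) (weil_index 0))/esym/eqP.
by rewrite !mxE eqxx mulr1 (negPf (mu_neq0 _)).
Qed.

(** The doubled form is the one that appears when Heisenberg operators are conjugated by each
    other. *)
Lemma mu_double_neq1 w : w != 0 -> exists u, mu (h u w + h u w) != 1.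
Proof.
move=> nzw; have [/existsP[u nu]|] := boolP [exists u, mu (h u w + h u w) != 1].
  by exists u.
rewrite negb_exists => /forallP w1; case/eqP: nzw;
  apply: (nondeg_eq0 hermh ndh) => u.
apply: (mu_primitive2 two plam) => a.
have := w1 (conjA a *: u); rewrite negbK => /eqP.
by rewrite !(hermZl hermh) conjAK.
Qed.

Lemma sum_mu_double w : w != 0 -> \sum_u mu (h u w + h u w) = 0.
Proof.
move/mu_double_neq1=> [u0 nu0]; set s := \sum_u _.
have e : s = mu (h u0 w + h u0 w) * s.
  rewrite mulr_sumr {1}/s (reindex_inj (addrI u0)); apply: eq_bigr => u _ /=.
  by rewrite -muD (hermDl hermh); congr (mu _); ring.
apply/eqP; have := subrr s; rewrite {2}e -{1}[s]mul1r -mulrBl => /eqP.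
by rewrite mulf_eq0 subr_eq0 eq_sym (negPf nu0).
Qed.

(* Conjugation by heis u multiplies heis w by a character of V which
   determines w. *)
Lemma heis_indep (f : V -> C) : \sum_w f w *: heis w = 0 -> forall w, f w = 0.
Proof.
move=> f0 w0.
have conj u w : heis (- u) *m heis w *m heis u = mu (h u w + h u w) *: heis w.
  rewrite heis_mul -scalemxAl heis_mul scalerA addrAC addNr add0r;
    congr (_ *: _).
  by rewrite (hermDr hermh) !(hermNr hermh) !muD !muN mu_self (mu_swap u w)
    invr1 mul1r invrK.
have fu u : \sum_w (f w * mu (h u w + h u w)) *: heis w = 0.
  transitivity (heis (- u) *m (\sum_w f w *: heis w) *m heis u).
    rewrite mulmx_sumr mulmx_suml; apply: eq_bigr => w _.
    by rewrite -scalemxAr -scalemxAl conj scalerA.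
  by rewrite f0 mulmx0 mul0mx.
(* Summing against the inverse of the character of w0 kills every other term and leaves [#|V|] times
   [f w0 *: heis w0]. *)
have : \sum_u mu (- (h u w0 + h u w0)) *: \sum_w (f w * mu (h u w + h u w)) *:
  heis w = 0.
  by apply: big1 => u _; rewrite fu scaler0.
under eq_bigr => u _ do rewrite scaler_sumr.
rewrite exchange_big /= (bigD1 w0) //= [X in _ + X]big1 => [|w nw]; last first.
  transitivity ((f w * \sum_u mu (h u (w - w0) + h u (w - w0))) *: heis w).
    rewrite mulr_sumr scaler_suml; apply: eq_bigr => u _;
      rewrite scalerA mulrCA -muD.
    by congr ((_ * mu _) *: _); rewrite (hermBr hermh); ring.
  by rewrite sum_mu_double ?mulr0 ?scale0r // subr_eq0.
under eq_bigr => u _ do rewrite scalerA mulrCA -muD addNr mu0 mulr1.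
rewrite addr0 sumr_const -scaler_nat scalerA => /eqP.
rewrite scaler_eq0 (negPf (heis_neq0 _)) orbF mulf_eq0 pnatr_eq0.
case/orP=> [|/eqP //]; rewrite -leqn0 leqNgt => /negP[].
by apply/card_gt0P; exists 0.
Qed.

(** Multiplication by y^l has kernel iV and image iV, so T and iV are equinumerous. Thus there are
    exactly as many Heisenberg operators as the dimension of End(X). *)
Lemma card_transversal : #|V| = (n * n)%N.
Proof.
have inj_y : {in T &, injective (fun v => y ^+ l *: v)}.
  move=> u v uT vT /eqP; rewrite -subr_eq0 -scalerBr.
  rewrite -(yV_iff locR l_gt0 nilM freeV) ?leq_addr // addnK => uv.
  have [s _ [_ us]] := transversal_modP trT u.
  by rewrite (us _ vT uv) (us u uT) // subrr yV0.
have cardiV : #|iV| = n.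
  rewrite -(card_in_imset inj_y); apply: eq_card => w.
  apply/yVP/imsetP => [[u ->]|[u _ ->]]; last by exists u.
  have [s sT [us _]] := transversal_modP trT u; exists s => //.
  apply/eqP; rewrite -subr_eq0 -scalerBr -(yV_iff locR l_gt0 nilM freeV)
    ?leq_addr //.
  by rewrite addnK.
rewrite -{2}cardiV -cardsX -cardsT.
rewrite -(card_in_imset (f := fun p : V * V => p.1 + p.2) (D := setX T iV)).
  apply: eq_card => v; rewrite inE; apply/esym/imsetP.
  have [s sT [vs _]] := transversal_modP trT v; exists (s, v - s);
    rewrite ?inE ?sT //=.
  by rewrite addrC subrK.
move=> [u1 w1] [u2 w2] /setXP[/= u1T w1V] /setXP[/= u2T w2V] e.
have [s _ [_ us]] := transversal_modP trT (u1 + w1).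
have e1 : u1 = s by apply: us => //; rewrite addrAC subrr add0r.
have e2 : u2 = s by apply: us => //; rewrite e addrAC subrr add0r.
by move: e; rewrite e1 e2 => /addrI ->.
Qed.

Lemma heis_span (M : 'M[C]_n) : exists f : V -> C, M = \sum_w f w *: heis w.
Proof.
apply: (span_image (A := predT)); suff -> : <<[seq heis w | w : V]>>%VS =
  fullv by apply: memvf.
apply/eqP; rewrite eqEdim subvf /= dim_span_image ?dimvf ?dim_matrix.
  by rewrite -[X in (X <= _)%N]card_transversal.
by move=> f f0 w _; apply: (heis_indep f0).
Qed.

Lemma heis_eq (f g : V -> C) :
  \sum_w f w *: heis w = \sum_w g w *: heis w -> f =1 g.
Proof.
move=> efg w; apply/eqP; rewrite -subr_eq0; apply/eqP; move: w;
  apply: heis_indep.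
under eq_bigr => w _ do rewrite scalerBl.
by rewrite sumrB efg subrr.
Qed.

(** * Block sums of Heisenberg operators and the commutant of U *)

Definition heis_block (B : {set V}) : 'M[C]_n := \sum_(w in B) heis w.

Definition block_span (P : {set {set V}}) : {vspace 'M[C]_n} :=
  <<[seq heis_block B | B in P]>>%VS.

Lemma dim_block_span P : trivIset P -> set0 \notin P ->
  \dim (block_span P) = #|P|.
Proof.
move=> tiP P0; apply: dim_span_image => f f0 B BP.
pose g w := if w \in cover P then f (pblock P w) else 0.
have g0 : \sum_w g w *: heis w = 0.
  rewrite -[RHS]f0 (bigID (mem (cover P))) /= [X in _ + X]big1 ?addr0;
    last first.
    by move=> w nw; rewrite /g (negPf nw) scale0r.
  rewrite big_trivIset //; apply: eq_bigr => B' B'P; rewrite scaler_sumr.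
  apply: eq_bigr => w wB'; rewrite /g (def_pblock tiP B'P wB').
  by have -> : w \in cover P by apply/bigcupP; exists B'.
have [w wB] : exists w, w \in B by apply/set0Pn; apply: contraNneq P0 => <-.
have := heis_indep g0 w; rewrite /g (def_pblock tiP BP wB).
by have -> : w \in cover P by apply/bigcupP; exists B.
Qed.

Lemma mem_block_span P (f : V -> C) : trivIset P ->
    (forall w, w \notin cover P -> f w = 0) ->
    (forall B, B \in P -> {in B &, forall u v, f u = f v}) ->
  \sum_w f w *: heis w \in block_span P.
Proof.
move=> tiP f0 fB; rewrite (bigID (mem (cover P))) /= [X in _ + X]big1 ?addr0;
  last first.
  by move=> w nw; rewrite f0 // scale0r.
rewrite big_trivIset //; apply: memv_suml => B BP.
have [->|/set0Pn[v vB]] := eqVneq B set0; first by rewrite big_set0 mem0v.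
have -> : \sum_(w in B) f w *: heis w = f v *: heis_block B.
  by rewrite scaler_sumr; apply: eq_bigr => w wB; rewrite (fB B BP w v).
by apply/memvZ/memv_span/image_f.
Qed.

Local Notation weil := (weil_mx h lam l T).

Definition commutes_weil (c : 'M[C]_n) :=
  {in U, forall g, c *m weil g = weil g *m c}.

Lemma weil_unit g : g \in U -> weil g \in unitmx.
Proof. exact: (repr_mx_unit (weil_repr nilM hermh lamP trT)). Qed.

Lemma block_commutes (B : {set V}) :
  (forall (g : {perm V}) v, g \in U -> v \in B -> g v \in B) ->
    commutes_weil (heis_block B).
Proof.
move=> stB g Ug; rewrite mulmx_suml mulmx_sumr.
under eq_bigr => w _ do rewrite heis_weil //.
rewrite [RHS](reindex_inj (@perm_inj _ g)); apply: eq_bigl => w.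
apply/idP/idP => [|gw]; first exact: stB.
rewrite -(permK g w).
by apply: (stB g^-1%g); rewrite ?groupV.
Qed.

(** Moving [weil g] across the sum replaces [heis w] by [heis (g w)]; independence of the operators
    then compares coefficients. *)
Lemma commutes_weilP (f : V -> C) :
  commutes_weil (\sum_w f w *: heis w) -> forall (g : {perm V}) v, g \in U ->
    f (g v) = f v.
Proof.
move=> cf g v Ug; have {cf} := cf g Ug; rewrite mulmx_suml mulmx_sumr.
under eq_bigr => w _ do rewrite -scalemxAl heis_weil // scalemxAr.
rewrite -!mulmx_sumr => /(can_inj (mulKmx (weil_unit Ug))).
rewrite [LHS](reindex_inj (@perm_inj _ g^-1)) /=.
under eq_bigr => w _ do rewrite permKV.
by move/heis_eq/(_ (g v)); rewrite permK.
Qed.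

Lemma commutes_weilM c d : commutes_weil c -> commutes_weil d ->
  commutes_weil (c *m d).
Proof. by move=> cc cd g Ug; rewrite -mulmxA cd // !mulmxA cc. Qed.

(* The map sum f(w) heis w |-> sum f(w) heis (sigma w) reverses products and
   fixes the commutant, so that the commutant is commutative. *)
Lemma commutant_comm c d : commutes_weil c -> commutes_weil d ->
  c *m d = d *m c.
Proof.
have [sg [sgK sgD sgh sgO]] :=
  semilinear_involution hermh ndh locR two l_gt0 nilM freeV.
have sgB u v : sg (u - v) = sg u - sg v.
  by apply/eqP; rewrite eq_sym subr_eq -sgD subrK.
have prodE (f g : V -> C) : (\sum_v f v *: heis v) *m (\sum_v g v *: heis v)
    = \sum_u (\sum_v f v * g (u - v) * mu (h (u - v) v)) *: heis u.
  under [RHS]eq_bigr => u _ do rewrite scaler_suml.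
  rewrite exchange_big mulmx_suml; apply: eq_bigr => v _ /=; rewrite mulmx_sumr.
  rewrite [RHS](reindex_inj (addIr v)); apply: eq_bigr => w _ /=.
  by rewrite addrK -scalemxAl -scalemxAr heis_mul !scalerA addrC.
have sg_inv (f : V -> C) : commutes_weil (\sum_w f w *: heis w) -> forall v,
  f (sg v) = f v.
  by move=> /commutes_weilP inv v; have /orbitP[g Ug <-] := sgO v;
    rewrite /= apermE inv.
move=> cc cd; have ccd := commutes_weilM cc cd.
have [f ef] := heis_span c; have [g eg] := heis_span d.
rewrite ef eg in cc cd ccd *; rewrite prodE in ccd *; rewrite prodE.
have inv := sg_inv _ ccd; apply: eq_bigr => u _; rewrite -inv; congr (_ *: _).
(* The coefficient of c d is taken at sigma u. Substituting sigma v for v on one side and u - v on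
   the other gives the same factor mu(h(v, u - v)) in both convolutions. *)
rewrite [LHS](reindex_inj (inv_inj sgK))
  [RHS](reindex_inj (inv_inj (subKr u))) /=.
apply: eq_bigr => v _; rewrite -sgB sgh !(sg_inv _ cc) !(sg_inv _ cd) subKr.
by rewrite (mulrC (g _)).
Qed.

Local Notation orbits B := (orbit 'P U @: B).

Lemma unitary_orbit_partition (B : {set V}) :
  (forall (g : {perm V}) v, g \in U -> v \in B -> g v \in B) ->
    partition (orbits B) B.
Proof.
move=> stB; apply: orbit_partition; apply/actsP => g Ug v /=; rewrite apermE.
apply/idP/idP => [gv|]; last exact: stB.
by rewrite -(permK g v); apply: stB; rewrite ?groupV.
Qed.

Lemma orbit_stable (g : {perm V}) u v :
  g \in U -> v \in orbit 'P U u -> g v \in orbit 'P U u.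
Proof.
move=> Ug /orbitP[k Uk <-]; apply/orbitP; exists (k * g)%g; first exact: groupM.
by rewrite /= !apermE permM.
Qed.

Lemma sub_commutes (P : {set {set V}}) c :
  (forall B, B \in P -> commutes_weil (heis_block B)) ->
  c \in block_span P -> commutes_weil c.
Proof.
move=> cP /span_image[f ->] g Ug; rewrite mulmx_suml mulmx_sumr.
by apply: eq_bigr => B BP; rewrite -scalemxAl -scalemxAr cP.
Qed.

Definition commutant : {vspace 'M[C]_n} := block_span (orbits [set: V]).

Lemma commutantP c : reflect (commutes_weil c) (c \in commutant).
Proof.
have /and3P[/eqP covT tiT _] : partition (orbits [set: V]) [set: V].
  by apply: unitary_orbit_partition => g v; rewrite !inE.
apply: (iffP idP) => [|cc].
  apply: sub_commutes => _ /imsetP[u _ ->]; apply: block_commutes => g v.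
  exact: orbit_stable.
have [f ef] := heis_span c; rewrite ef in cc *.
apply: mem_block_span => // [w|_ /imsetP[u _ ->] v w];
  first by rewrite covT inE.
move=> /orbitP[g Ug <-] /orbitP[k Uk <-] /=.
by rewrite !apermE !(commutes_weilP cc).
Qed.

Lemma dim_commutant : \dim commutant = #|orbits [set: V]|.
Proof.
have /and3P[_ tiT nT] : partition (orbits [set: V]) [set: V].
  by apply: unitary_orbit_partition => g v; rewrite !inE.
exact: dim_block_span.
Qed.

(** * The projection onto Top and the elements of the commutant that it kills *)

Definition prim_mx : 'M[C]_n := diag_mx (\row_i (t i \notin yV V 1)%:R).

Lemma mul_prim_mx (M : 'M[C]_n) i j : (M *m prim_mx) i j =
  M i j *+ (t j \notin yV V 1).
Proof. by rewrite mul_mx_diag !mxE mulr_natr. Qed.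

Lemma prim_mx_commutes : commutes_weil prim_mx.
Proof.
move=> g Ug; apply/matrixP => i j; rewrite mul_prim_mx mul_diag_mx !mxE.
rewrite mulr_natl -/(t i) -/(t j) /=.
have [gij|_] := boolP (g (t i) - t j \in iV); last by rewrite !mul0rn.
suff -> : (t j \in yV V 1) = (t i \in yV V 1) by [].
have gij1 : g (t i) - t j \in yV V 1 by apply: (subsetP (yVS V l_gt0)).
apply/idP/idP => [yj|yi]; last first.
  by rewrite -[t j](subKr (g (t i))) yVB // (unitary_yV Ug).
rewrite -(permK g (t i)); apply: (@unitary_yV _ _ _ h); rewrite ?groupV //.
by rewrite -(subrK (t j) (g _)) yVD.
Qed.

(** The annihilator of y in V. *)
Let N : {set V} := yV V (l + l).-1.

Let l2_gt0 : (0 < l + l)%N.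
Proof. by rewrite addn_gt0 l_gt0. Qed.

Let N_le : ((l + l).-1 <= l + l)%N.
Proof. exact: leq_pred. Qed.

Let N_sub : N \subset iV.
Proof. by apply: yVS; rewrite -ltnS prednK // -addn1 leq_add2l. Qed.

(** As w lies in iV, translation by w only rescales each e_v. *)
Lemma heis_socle w : w \in N ->
  heis w = diag_mx (\row_i mu (h w (t i) + h w (t i))).
Proof.
move=> wN; have wi := subsetP N_sub _ wN; apply/row_matrixP => i.
have e : weil_vec (t i + w) = mu (h w (t i)) *: delta_mx 0 i.
  rewrite (weil_vec_congr (v := t i)) ?weil_vec_t;
    last by rewrite addrAC subrr add0r.
  by rewrite (hermDl hermh) muD mu_self mul1r.
by rewrite rowK e scalerA -muD row_diag_mx mxE.
Qed.

Lemma herm_socle w u : w \in N -> u \in yV V 1 -> h w u = 0.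
Proof.
move=> /yVP[w' ->] /yVP[u' ->]; rewrite (hermZr hermh) (hermZl hermh).
rewrite -[y ^+ (l + l).-1]mulr1 conjA_Xn -!mulrA mulrCA (mulrA (y ^+ 1)) -exprD.
by rewrite add1n prednK // (ramY_ll nilM) mul0r mulr0.
Qed.

Lemma herm_socle_neq1 u : u \notin yV V 1 ->
  exists2 w, w \in N & mu (h w u + h w u) != 1.
Proof.
have e1 : (1 = l + l - (l + l).-1)%N by rewrite -subn1 subKn.
rewrite [X in yV V X]e1 (yV_iff locR l_gt0 nilM freeV) // =>
  /mu_double_neq1[w'].
(* The sign [a] cancels the one that y^(2l-1) acquires under the involution when it moves to the
   first argument. *)
rewrite (hermZr hermh) => nw'; pose a : A := (-1) ^+ (l + l).-1.
have conj_a : conjA a = a.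
  rewrite /a; elim: (l + l).-1 => [|k IHk]; first exact: conjA_1.
  by rewrite exprS conjA_mul IHk conjA_opp conjA_1.
exists (y ^+ (l + l).-1 *: (a *: w')); first by apply/yVP; exists (a *: w').
rewrite scalerA (hermZl hermh) conjA_Xn conj_a mulrCA -/a -expr2.
by rewrite sqrr_sign mulr1.
Qed.

(** Right and left multiplication by [heis w] twist the translated coefficients by mutually inverse
    factors; comparing the two conditions will restrict the support of [f]. *)
Lemma right_socle_invariant (f : V -> C) w :
    (\sum_v f v *: heis v) *m heis w = \sum_v f v *: heis v ->
  forall u, f u = f (u - w) * mu (h w (u - w)).
Proof.
move=> e; apply: heis_eq; rewrite -{1}e mulmx_suml.
rewrite [RHS](reindex_inj (addIr w)); apply: eq_bigr => v _ /=.
by rewrite -scalemxAl heis_mul scalerA addrK.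
Qed.

Lemma left_socle_invariant (f : V -> C) w :
    heis w *m (\sum_v f v *: heis v) = \sum_v f v *: heis v ->
  forall u, f u = f (u - w) * mu (h (u - w) w).
Proof.
move=> e; apply: heis_eq; rewrite -{1}e mulmx_sumr.
rewrite [RHS](reindex_inj (addIr w)); apply: eq_bigr => v _ /=.
by rewrite -scalemxAr heis_mul scalerA addrK addrC.
Qed.

Definition pullback (B : {set V}) : {set V} := [set v | y *: v \in B].

Definition pullback_orbits : {set {set V}} := pullback @: orbits (yV V 2).

Lemma y2E v : v \in yV V 1 -> y *: v \in yV V 2.
Proof. by case/yVP=> u ->; apply/yVP; exists u; rewrite scalerA -exprS. Qed.

Lemma y_diff_socle u v : y *: u = y *: v -> u - v \in N.
Proof.
move=> /eqP; rewrite -subr_eq0 -scalerBr -[y]expr1.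
by rewrite -(yV_iff locR l_gt0 nilM freeV) ?subn1 // addn_gt0 l_gt0.
Qed.

(** If y v = y^2 u, then v - y u is annihilated by y, hence lies in N, which is contained in yV. *)
Lemma y2_inv v : y *: v \in yV V 2 -> v \in yV V 1.
Proof.
case/yVP=> u e; have vN : v - y *: u \in N by apply: y_diff_socle;
  rewrite e scalerA.
rewrite -(subrK (y *: u) v); apply: yVD; last by apply/yVP; exists u.
by apply: (subsetP (yVS V _)) vN; rewrite -ltnS prednK // -addn1 leq_add.
Qed.

Let y2_stable (g : {perm V}) v : g \in U -> v \in yV V 2 -> g v \in yV V 2.
Proof. exact: unitary_yV. Qed.

Lemma pullback_stable B : B \in pullback_orbits ->
  [/\ forall v, v \in B -> v \in yV V 1,
      forall (g : {perm V}) v, g \in U -> v \in B -> g v \in B &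
      forall v w, w \in N -> v \in B -> v + w \in B].
Proof.
case/imsetP=> _ /imsetP[u u2 ->] ->; split=> [v|g v Ug|v w]; rewrite !inE.
- case/orbitP=> g Ug /= e; apply: y2_inv; rewrite -e apermE; exact: y2_stable.
- by rewrite -(unitaryZ _ _ Ug); apply: orbit_stable.
rewrite scalerDr => wN; suff -> : y *: w = 0 by rewrite addr0.
case/yVP: wN => w' ->; rewrite scalerA -exprS prednK //.
by rewrite (ramY_ll nilM) scale0r.
Qed.

Lemma pullback_part : [/\ trivIset pullback_orbits, set0 \notin pullback_orbits,
  cover pullback_orbits = yV V 1 & #|pullback_orbits| = #|orbits (yV V 2)|].
Proof.
have orb1 u v w : v \in orbit 'P U u -> v \in orbit 'P U w ->
  orbit 'P U u = orbit 'P U w.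
  by move=> /orbit_eqP <- /orbit_eqP <-.
split.
- apply/trivIsetP => _ _ /imsetP[_ /imsetP[u _ ->] ->]
  /imsetP[_ /imsetP[w _ ->] ->].
  apply: contraR => /pred0Pn[v /=]; rewrite !inE => /andP[vu vw].
  by rewrite (orb1 _ _ _ vu vw).
- apply/imsetP => -[_ /imsetP[u /yVP[v ev] ->] /setP/(_ (y *: v))].
  by rewrite !inE scalerA -expr2 -ev orbit_refl.
- apply/setP => v; apply/bigcupP/idP => [[B /pullback_stable[sB _ _]]|v1];
  first exact: sB.
  exists (pullback (orbit 'P U (y *: v)%R)); last by rewrite inE orbit_refl.
  by apply/imset_f/imset_f/y2E.
apply: card_in_imset => _ _ /imsetP[u /yVP[v ev] ->] /imsetP[w _ ->]
  /setP/(_ (y *: v)).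
rewrite !inE scalerA -expr2 -ev orbit_refl => /esym uw.
by apply: orb1 uw; apply: orbit_refl.
Qed.

(** The diagonal operators [heis w] with w in N fix the imprimitive e_v, while each primitive e_v is
    scaled by some of them by a factor other than 1. Hence [c *m prim_mx = 0] amounts to
    [c *m heis w = c] for all w in N. *)
Lemma prim_mx_kernel c : c \in commutant ->
  (c *m prim_mx == 0) = (c \in block_span pullback_orbits).
Proof.
have [tiP _ covP _] := pullback_part.
move=> cE; have cc := elimT (commutantP c) cE; apply/eqP/idP => [cP0|].
  pose Q := 1%:M - prim_mx.
  have QE : Q *m c = c *m Q.
    by rewrite mulmxBl mulmxBr mul1mx mulmx1
      (commutant_comm cc prim_mx_commutes).
  have cQ : c *m Q = c by rewrite mulmxBr cP0 mulmx1 subr0.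
  have mQ w : w \in N -> heis w *m Q = Q /\ Q *m heis w = Q.
    move=> wN; have e i : (t i \notin yV V 1)%:R * mu (h w (t i) + h w (t i)) =
        (t i \notin yV V 1)%:R + (mu (h w (t i) + h w (t i)) - 1).
      have [yi|_] := boolP (t i \in yV V 1);
        last by rewrite mul1r addrCA subrr addr0.
      by rewrite (herm_socle wN yi) addr0 mu0 mul0r subrr addr0.
    have hP : heis w *m prim_mx = prim_mx + (heis w - 1%:M).
      rewrite heis_socle // mulmx_diag -diag_const_mx -!raddfB -raddfD;
        congr diag_mx.
      by apply/rowP => i; rewrite !mxE mulrC e.
    have Ph : prim_mx *m heis w = prim_mx + (heis w - 1%:M).
      by rewrite -hP heis_socle // diag_mxC.
    split; first by rewrite mulmxBr mulmx1 hP opprD addrCA subKr addrC.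
    by rewrite mulmxBl mul1mx Ph opprD addrCA subKr addrC.
  have [f ef] := heis_span c.
  have fr w (wN : w \in N) : forall u, f u = f (u - w) * mu (h w (u - w)).
    by apply: right_socle_invariant; rewrite -ef -{1}cQ -mulmxA (mQ w wN).2 cQ.
  have fl w (wN : w \in N) : forall u, f u = f (u - w) * mu (h (u - w) w).
    by apply: left_socle_invariant;
      rewrite -ef -{1}cQ -QE mulmxA (mQ w wN).1 QE cQ.
  rewrite ef in cc *; apply: mem_block_span => // [u|B BP u v uB vB].
    (* The left condition gives f(u - w) = f(u) a and the right one f(u) = f(u - w) a, so f(u) =
       f(u) a^2 with a^2 = mu(2 h(w, u)) different from 1. *)
    rewrite covP => /herm_socle_neq1[w wN nw]; set a := mu (h w (u - w)).
    have a2 : mu (h w u + h w u) = a * a.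
      by rewrite muD /a (hermBr hermh) (muD (h w u)) muN mu_self invr1 mulr1.
    have fa : f (u - w) = f u * a.
      by rewrite (fl w wN u) (mu_swap w (u - w)) -/a mulfVK // mu_neq0.
    apply/eqP; have := fr w wN u; rewrite fa -/a -mulrA -a2 => /eqP.
    rewrite -{1}[f u]mulr1 -subr_eq0 -mulrBr mulf_eq0 subr_eq0 (eq_sym 1)
      (negPf nw).
    by rewrite orbF.
  have [sB _ _] := pullback_stable BP.
  have {BP} [g Ug e] : exists2 g : {perm V}, g \in U & g (y *: u) = y *: v.
    case/imsetP: BP uB vB => _ /imsetP[w _ ->] ->; rewrite !inE.
    move=> /orbitP[g1 U1 <-] /orbitP[g2 U2 <-].
    exists (g1^-1 * g2)%g; first by apply: groupM; rewrite ?groupV.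
    by rewrite /= !apermE permM permK.
  (* v and g u differ by an element of N, and the twisting factor is 1 because N is orthogonal to
     yV. *)
  have vgN : v - g u \in N by apply: y_diff_socle; rewrite -(unitaryZ _ _ Ug).
  rewrite (fr _ vgN v) (hermBr hermh) (herm_socle vgN (sB v vB)).
  rewrite sub0r muN mu_self invr1 mulr1 opprB addrC subrK.
  by rewrite (commutes_weilP cc).
case/span_image => f ->; rewrite mulmx_suml big1 // => B BP.
have [sB _ tB] := pullback_stable BP.
rewrite -scalemxAl; set M := heis_block B; suff -> : M *m prim_mx =
  0 by rewrite scaler0.
have Mw w : w \in N -> M *m heis w = M.
  move=> wN; rewrite mulmx_suml [RHS](reindex_inj (addIr w)) /=.
  apply: eq_big => [v|v vB];
    last by rewrite heis_mul (herm_socle wN (sB v vB)) mu0 scale1r.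
  apply/idP/idP => [|vw]; first exact: tB.
  by rewrite -(addrK w v); apply: tB => //; apply: yVN.
apply/matrixP => i j; rewrite mul_prim_mx mxE.
have [_|yj] := boolP (t j \in yV V 1); first by rewrite mulr0n.
(* [heis w] multiplies column j by a factor other than 1, yet fixes [M], so this column is zero. *)
have [w wN nw] := herm_socle_neq1 yj; rewrite mulr1n; apply/eqP.
have /matrixP/(_ i j)/eqP := Mw w wN; rewrite heis_socle // mul_mx_diag !mxE.
rewrite -subr_eq0 -{2}[M i j]mulr1 -mulrBr mulf_eq0 subr_eq0 (negPf nw).
by rewrite orbF.
Qed.

Lemma pullback_sub_commutant : (block_span pullback_orbits <= commutant)%VS.
Proof.
apply/span_subvP => _ /imageP[B BP ->]; apply/commutantP/block_commutes.
by have [_ ? _] := pullback_stable BP.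
Qed.

(** The subset y^2V is U-stable, so the orbits of V, which count the dimension of the commutant,
    split into those inside y^2V, which count the kernel, and those outside. *)
Lemma dim_commutant_kernel (W : {vspace 'M[C]_n}) :
    (forall c, c \in commutant -> (c \in W) = (c *m prim_mx == 0)) ->
  (\dim (commutant :&: W) + #|orbits (~: yV V 2)|)%N = \dim commutant.
Proof.
move=> eW; have [tiP nP _ cardP] := pullback_part.
have -> : (commutant :&: W)%VS = block_span pullback_orbits.
  apply/vspaceP => c; rewrite memv_cap;
    have [cE|ncE] := boolP (c \in commutant).
    by rewrite eW // prim_mx_kernel.
  by apply/esym/negP => /(subvP pullback_sub_commutant); apply/negP.
rewrite dim_block_span // cardP dim_commutant -(setUCr (yV V 2)) imsetU cardsU.
rewrite (_ : _ :&: _ = set0) ?cards0 ?subn0 //; apply/setP => B; rewrite !inE.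
apply/andP => -[/imsetP[u u2 ->] /imsetP[v]]; rewrite inE => /negP nv e;
  apply: nv.
have : v \in orbit 'P U u by rewrite e orbit_refl.
by case/orbitP=> g Ug <-; rewrite /= apermE; apply: y2_stable.
Qed.

End Heisenberg.

Theorem theorem7p8 (K : realType)
    (R : finComNzRingType) (p : nat) (podd : odd p) (charR : p \in [pchar R])
    (prR : principal_ring R)
    (x : R) (locR : local_ring (pideal x))
    (l : nat) (l_gt0 : (0 < l)%N) (nilM : nilpotency_degree (pideal x) l)
    (V : finLmodType (ramified_ext x))
    (m : nat) (m_gt0 : (0 < m)%N) (freeV : free_of_rank V m)
    (h : V -> V -> ramified_ext x)
    (hermh : hermitian_form h) (ndh : nondegenerate_form h)
    (lam : R -> K[i]) (lamP : additive_char lam) (plam : primitive_char lam)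
    (T : {set V}) (trT : transversal_mod T (yV V l)) :
  nb_irr_constituents (Top_repr nilM hermh lamP trT l_gt0)
    = #|orbit 'P (unitary h) @: ~: yV V 2|.
Proof.
have two := odd_pchar_half podd charR.
pose E := commutant h lam trT; pose P := prim_mx K[i] T.
have EP c : reflect (commutes_weil h lam l c) (c \in E).
  exact: (commutantP hermh ndh locR two l_gt0 nilM freeV lamP plam trT).
have commE : {in E &, forall c d, c *m d = d *m c}.
  move=> c d /EP cc /EP cd.
  exact: (commutant_comm hermh ndh locR two l_gt0 nilM freeV lamP plam trT).
pose Z : {vspace 'M[K[i]]_#|T|} := lker (linfun (mulmxr P)).
have memZ c : (c \in Z) = (c *m P == 0) by rewrite memv_ker lfunE.
(* Both numbers complete the dimension of the kernel to that of the commutant. *)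
apply: (@addnI (\dim (E :&: Z))).
rewrite (dim_commutant_kernel hermh ndh locR two l_gt0 nilM freeV lamP plam) //.
apply: (@card_socle_submod _ _ _ _ (weil_repr nilM hermh lamP trT) E _ _ _ _ P)=> //.
- by rewrite pnatr_eq0 -lt0n cardG_gt0.
- by apply/EP; apply: prim_mx_commutes.
- apply/row_subP => i; rewrite row_diag_mx mxE.
  case: (boolP (enum_val i \in yV V 1)) => [_|prim_i];
    first by rewrite scale0r sub0mx.
  by rewrite scale1r (sumsmx_sup i) ?genmxE.
apply/eqP; rewrite eq_sym -subr_eq0 -{1}[Top_mx _ _]mulmx1 -mulmxBr;
  apply/eqP/sub_kermxP.
apply/sumsmx_subP => i prim_i; rewrite genmxE; apply/sub_kermxP.
by rewrite mulmxBr mulmx1 -rowE row_diag_mx mxE prim_i scale1r subrr.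
Qed.
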